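(* Let $k\ge4$ be an integer and $0\le\lambda\le1$. For every $\epsilon>0$, $$\int_{|x|\le1}\int_0^\lambda\Big|\sum_{n\sim N}e(xn^2+yn^k)\Big|^6dy\,dx\lesssim_\epsilon\lambda N^{3+\epsilon}+N^{4-k+\epsilon}.$$ In particular, for each fixed constant $C>0$ the system $$\begin{cases}|n_1^k+n_2^k+n_3^k-n_4^k-n_5^k-n_6^k|\le CN^{k-1}\\ n_1^2+n_2^2+n_3^2=n_4^2+n_5^2+n_6^2\end{cases}$$ has $O(N^{3+\epsilon})$ solutions in integers $n_1,\dots,n_6$ with $n_i\sim N$.
   Context: $e(a)=e^{2\pi i a}$. $n\sim N$ means that the integer $n$ satisfies $c_1N\le n\le c_2N$ for fixed constants $0<c_1<c_2$. The implicit constants may depend on $\epsilon,k,C,c_1,c_2$ but not on $N\ge1$ or $\lambda$. *)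

(* Defs.v *)
From mathcomp Require Import all_boot all_order all_algebra.
From mathcomp Require Import all_classical all_reals all_analysis.
From mathcomp Require Import complex.

Set Implicit Arguments.
Unset Strict Implicit.
Unset Printing Implicit Defensive.

Import Order.TTheory GRing.Theory Num.Theory.
Import numFieldNormedType.Exports.
Import ComplexField.Normc.

Local Open Scope classical_set_scope.
Local Open Scope complex_scope.
Local Open Scope ring_scope.

Definition e (R : realType) (a : R) : R[i] :=
  cos (2 * pi * a) +i* sin (2 * pi * a).

(* The integers n with n ~ N, where c1 and c2 are the implied constants.  *)
Definition dyadic (R : realType) (c1 c2 N : R) : set int :=
  [set n | c1 * N <= n%:~R <= c2 * N].

(* \sum_(n \in A) is a finitely supported sum, equal to 0 if the support is
   infinite; this lemma rules that case out. *)
Lemma finite_dyadic (R : realType) (c1 c2 N : R) :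
  finite_set (dyadic c1 c2 N).
Proof.
have [B hB] : exists B : nat, `|c1 * N| + `|c2 * N| < B%:R :> R.
  by exists (Num.bound (`|c1 * N| + `|c2 * N|)); rewrite archi_boundP ?addr_ge0.
apply: (@sub_finite_set _ _ ((Posz @` `I_B) `|` (Negz @` `I_B))).
  move=> [] n /= /andP[h1 h2]; [left|right]; exists n => //=.
    rewrite -(ltr_nat R); apply: le_lt_trans hB.
    by rewrite (le_trans h2)// (le_trans (ler_norm _))// lerDr.
  rewrite -(ltr_nat R); apply: le_lt_trans hB.
  have hn : n.+1%:R <= - (c1 * N) by rewrite lerNr; rewrite NegzE mulrNz in h1.
  have h : n%:R <= n.+1%:R :> R by rewrite ler_nat.
  apply: (le_trans h); apply: (le_trans hn).
  by rewrite (le_trans (ler_norm _))// normrN lerDl.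
by rewrite finite_setU; split; apply: finite_image; exact: finite_II.
Qed.

Definition expsum (R : realType) (k : nat) (c1 c2 N x y : R) : R[i] :=
  \sum_(n \in dyadic c1 c2 N) e (x * n%:~R ^+ 2 + y * n%:~R ^+ k).

Definition sixth_moment (R : realType) (k : nat) (c1 c2 N lambda : R) : \bar R :=
  \int[lebesgue_measure]_(x in [set x : R | `|x| <= 1])
    \int[lebesgue_measure]_(y in `[0%R, lambda])
      (normc (expsum k c1 c2 N x y) ^+ 6)%:E.

Definition system_solutions (R : realType) (k : nat) (c1 c2 C N : R) :
    set (6.-tuple int) :=
  [set n : 6.-tuple int |
    [/\ forall i : 'I_6, dyadic c1 c2 N (tnth n i),
        `|n`_0 ^+ k + n`_1 ^+ k + n`_2 ^+ k
          - n`_3 ^+ k - n`_4 ^+ k - n`_5 ^+ k|%:~R <= C * N ^+ k.-1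
      & n`_0 ^+ 2 + n`_1 ^+ 2 + n`_2 ^+ 2
          = n`_3 ^+ 2 + n`_4 ^+ 2 + n`_5 ^+ 2]].

(* Main.v *)
Require Import Defs.
From mathcomp Require Import all_boot all_order all_algebra.
From mathcomp Require Import finmap complex zify ring lra.
From mathcomp Require Import all_classical all_reals all_analysis.

(** Expanding the sixth power and integrating exactly, the [x]-integral over two
    periods keeps the sextuples with equal sums of squares, and the [y]-integral
    then weighs each of them by at most [min(lambda, 1/|gap|)], where [gap] is the
    difference of the two sums of k-th powers ([sixth_moment_le]).  Both claims
    thus follow from one count ([core_count]): for every shift [T], the sextuples
    with equal sums of squares whose gap lies in a given interval of length
    [O(N^(k-1))] starting at [T] number [O(N^(3+eps))].  The system uses the
    interval at [0]; the moment sums over consecutive intervals, which costs a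
    harmonic sum ([sum_gap_weight_le]).

    The count is the l^2 decoupling inequality in [L^6] for the curve
    [n |-> (n^2, n^k)], carried out on finite sums.  One frequency
    [f(n) = n^k + Q n^2] with [Q] huge encodes both equations, the circle becomes
    [Z/M], and the k-th powers are only asked to balance up to [H] by weighting
    with the square of a Dirichlet kernel of length [H], whose Fourier transform
    is nonnegative and supported in [(-H, H)].  If [F_I] is the exponential sum
    over a window [I] of consecutive integers, the weighted mean of [|F_I|^6]
    counts, up to constants, the solutions with entries in [I] ([count_le_mean],
    [base_mean]); the count for a shifted difference is an inner product bounded by
    the same mean.

    Short windows have length [r], about the square root of [N].  On them [n^k]
    is linear up to [O(N^(k-1))]: writing [n_i = m + h_i], the signed sum of the
    [h_i] is an integer [d = O(1)], and the signed sum of their squares is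
    then [- 2 m d].  Such a system has [r^(3+eps)] solutions, because
    [2 (h_1 - h_4) (h_2 - h_4)] is determined by [d] and the other three
    variables, and a nonzero integer has few divisors ([card_base]).

    It remains to pass from length [r] to length [r s^p], with [s] a constant and
    [r s^p] of order [N], losing only [s^(eps p)] over the trivial factor [s^(3p)].
    Let [a(q)] be the supremum of the mean of [|F_I|^6] over windows of length
    [r s^q], divided by [s^(3q)] and by the value for short windows, and let
    [b(alpha, beta)] be the analogous normalised supremum of the means of
    [|F_I|^2 |F_J|^4] over separated windows of lengths [r s^(p-alpha)] and
    [r s^(p-beta)].  Splitting a window in [s] pieces, either neighbouring pieces
    dominate or two separated ones are large, so that
    [a(p) <= a(p-1)/4 + s^8 b(1,1)].  The combination of the two equations whose
    derivative vanishes on [J] is steep on [I]; hence pieces of [I] of length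
    about [|J|^2 / dist(I,J)] are orthogonal against [|F_J|^4] ([far_orthogonal]),
    and [b(alpha, beta) <= 3 b(2 beta - 2, beta)].  By Cauchy-Schwarz
    [b(2 beta - 2, beta)^2 <= b(beta, 2 beta - 2) a(p - beta)].  Alternating the
    two steps doubles [beta] each time, and each application of a known bound
    [a(q) <= C sigma^q] at the shorter length [p - beta] saves a power of [sigma];
    after [n] rounds the saving beats the cost of getting started and yields
    [a(q) <= C' (sigma / theta)^q] for some [theta > 1] ([bootstrap_step]).
    Finitely many repetitions lower [sigma] from the trivial [s^3] to
    [s^(eps/2)] ([bootstrap], [decoupling]). *)

Set Implicit Arguments.
Unset Strict Implicit.
Unset Printing Implicit Defensive.

Import Order.TTheory GRing.Theory Num.Theory.
Import numFieldNormedType.Exports.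
Import ComplexField.Normc.

Local Open Scope ring_scope.

Local Notation Re := complex.Re.

(** * Characters of a finite cyclic group *)

Definition far q (i j : 'I_q) := (i.+1 < j)%N || (j.+1 < i)%N.

Lemma card_not_far q (i : 'I_q) : (#|(fun j => ~~ far i j)| <= 3)%N.
Proof.
rewrite cardE -(size_map val) (@uniq_leq_size _ _ [:: i.-1; i : nat; i.+1])//.
  by rewrite map_inj_uniq ?enum_uniq//; exact: val_inj.
move=> _ /mapP[j + ->]; rewrite mem_enum unfold_in /far !inE /= => h; lia.
Qed.

Section Characters.
Variable R : realType.
Implicit Types a b : R.

Lemma eD a b : e (a + b) = e a * e b.
Proof.
rewrite /e mulrDr cosD sinD; apply/eqP; rewrite eq_complex /=.
by apply/andP; split; apply/eqP; rewrite // addrC; congr (_ + _); exact: mulrC.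
Qed.

Lemma e0 : e (0 : R) = 1.
Proof. by rewrite /e mulr0 cos0 sin0. Qed.

Lemma e1 : e (1 : R) = 1.
Proof. by rewrite /e mulr1 mulr_natl cos2pi sin2pi. Qed.

Lemma eMn a n : e (a * n%:R) = e a ^+ n.
Proof.
elim: n => [|n IH]; first by rewrite mulr0 e0.
by rewrite -addn1 natrD mulrDr mulr1 eD IH addn1 exprSr.
Qed.

Lemma conj_e a : conjc (e a) = e (- a).
Proof. by rewrite /e mulrN cosN sinN. Qed.

Lemma normc_e a : normc (e a) = 1.
Proof. by rewrite /e /= cos2Dsin2 sqrtr1. Qed.

Lemma e_neq1 a : 0 < a < 1 -> e a != 1.
Proof.
move=> /andP[a0 a1]; rewrite eq_complex /= negb_and; apply/orP; left.
have s0 : 0 < sin (pi * a) :> R.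
  apply: sin_gt0_pi; rewrite mulr_gt0 ?pi_gt0//=.
  by rewrite -[X in _ < X]mulr1 ltr_pM2l ?pi_gt0.
have -> : 2 * pi * a = (pi * a) *+ 2 :> R by rewrite -mulr_natl; ring.
rewrite cos_mulr2n cos2sin2; apply/eqP => h.
have : 0 < sin (pi * a) ^+ 2 :> R by rewrite exprn_gt0.
lra.
Qed.

Lemma Re_sum (I : Type) (r : seq I) (P : pred I) (F : I -> R[i]) :
  Re (\sum_(i <- r | P i) F i) = \sum_(i <- r | P i) Re (F i).
Proof. by apply: (big_morph (@complex.Re R)) => // -[? ?] [? ?]. Qed.

Lemma conjcM (x y : R[i]) : conjc (x * y) = conjc x * conjc y.
Proof. exact: rmorphM. Qed.

Lemma conjc_sum (I : Type) (r : seq I) (P : pred I) (F : I -> R[i]) :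
  conjc (\sum_(i <- r | P i) F i) = \sum_(i <- r | P i) conjc (F i).
Proof. exact: rmorph_sum. Qed.

Lemma normc_sqr (x : R[i]) : normc x ^+ 2 = Re (x * conjc x).
Proof.
case: x => a b /=; rewrite sqr_sqrtr ?addr_ge0 ?sqr_ge0//; ring.
Qed.

Lemma normc_ge0 (x : R[i]) : 0 <= normc x.
Proof. by case: x => a b /=; exact: sqrtr_ge0. Qed.

Lemma normcX (x : R[i]) n : normc (x ^+ n) = normc x ^+ n.
Proof.
by elim: n => [|n IH]; rewrite ?expr0 ?normc1// !exprS normcM IH.
Qed.

Lemma normc_sum (I : Type) (r : seq I) (P : pred I) (F : I -> R[i]) :
  normc (\sum_(i <- r | P i) F i) <= \sum_(i <- r | P i) normc (F i).
Proof.
elim/big_ind2: _ => [|x a y b hx hy|i _]; rewrite ?normc0//.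
by apply: le_trans (le_normcD _ _) _; exact: lerD.
Qed.

Lemma Re_mul_conj_le (x y : R[i]) :
  Re (x * conjc y) <= (normc x ^+ 2 + normc y ^+ 2) / 2.
Proof.
rewrite !normc_sqr; case: x => a b; case: y => c d /=.
have := sqr_ge0 (a - c); have := sqr_ge0 (b - d); nra.
Qed.

Lemma normc_sqr_sum (I : finType) (X : I -> R[i]) :
  normc (\sum_i X i) ^+ 2 = \sum_i \sum_j Re (X i * conjc (X j)).
Proof.
rewrite normc_sqr conjc_sum mulr_suml Re_sum; apply: eq_bigr => i _.
by rewrite mulr_sumr Re_sum.
Qed.

Variable M : nat.
Hypothesis M0 : (0 < M)%N.

Definition character (x : nat) (t : 'I_M) : R[i] := e (x%:R * t%:R / M%:R).

Lemma characterD x y t : character (x + y) t = character x t * character y t.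
Proof. by rewrite /character natrD !mulrDl eD. Qed.

Lemma normc_character x t : normc (character x t) = 1.
Proof. exact: normc_e. Qed.

Lemma character_orthogonal (x y : nat) : (x < M)%N -> (y < M)%N ->
  \sum_(t < M) character x t * conjc (character y t) = if x == y then M%:R else 0.
Proof.
have Mn0 : (M%:R : R) != 0 by rewrite pnatr_eq0 -lt0n.
wlog xy : x y / (y <= x)%N.
  move=> H xM yM; have [yx|/ltnW xy] := leqP y x; first exact: H.
  have := congr1 conjc (H _ _ xy yM xM); rewrite conjc_sum eq_sym => E.
  transitivity (conjc (if x == y then M%:R else 0 : R[i])).
    by rewrite -E; apply: eq_bigr => t _; rewrite conjcM conjcK mulrC.
  by case: ifP => _; rewrite ?rmorph_nat ?rmorph0.
move=> xM yM.
set w := e ((x - y)%:R / M%:R : R).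
transitivity (\sum_(t < M) w ^+ t).
  apply: eq_bigr => t _; rewrite /w /character conj_e -eD -eMn; congr e.
  by rewrite natrB//; ring.
have [exy|nxy] := eqVneq x y.
  rewrite /w exy subnn mul0r e0; under eq_bigr do rewrite expr1n.
  by rewrite sumr_const card_ord.
have w1 : w != 1.
  have lt_yx : (y < x)%N by rewrite ltn_neqAle eq_sym nxy.
  apply: e_neq1; rewrite divr_gt0 ?ltr0n ?subn_gt0//=.
  by rewrite ltr_pdivrMr ?ltr0n// mul1r ltr_nat; lia.
have wM : w ^+ M = 1.
  by rewrite /w -eMn divfK// -[_%:R]mul1r eMn e1 expr1n.
have w1' : w - 1 != 0 by rewrite subr_eq0.
by apply: (mulfI w1'); rewrite mulr0 -subrX1 wM subrr.
Qed.

Definition charsum (T : finType) (x : T -> nat) (t : 'I_M) : R[i] :=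
  \sum_i character (x i) t.

Lemma charsumM (T U : finType) (x : T -> nat) (y : U -> nat) t :
  charsum x t * charsum y t = charsum (fun p : T * U => x p.1 + y p.2)%N t.
Proof.
rewrite /charsum mulr_suml (eq_bigr (fun i => \sum_j character (x i) t * character (y j) t)).
  rewrite pair_bigA; apply: eq_bigr => -[i j] _ /=; by rewrite characterD.
by move=> i _; rewrite mulr_sumr.
Qed.

(** Coincidences between two families of frequencies are counted by the inner
    product of their exponential sums; with no coincidence the sums are
    orthogonal, which is how orthogonality is established below. *)
Lemma parseval (T U : finType) (x : T -> nat) (y : U -> nat) :
  (forall i, x i < M)%N -> (forall j, y j < M)%N ->
  \sum_(t < M) charsum x t * conjc (charsum y t)
    = (M * #|[pred p : T * U | x p.1 == y p.2]|)%:R.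
Proof.
move=> hx hy.
transitivity (\sum_(p : T * U) (if x p.1 == y p.2 then M%:R else 0 : R[i])).
  rewrite -(pair_bigA _ (fun i j => if x i == y j then M%:R else 0)) /=.
  under eq_bigr => t _ do rewrite /charsum conjc_sum mulr_suml.
  rewrite exchange_big; apply: eq_bigr => i _.
  under eq_bigr => t _ do rewrite mulr_sumr.
  by rewrite exchange_big; apply: eq_bigr => j _; exact: character_orthogonal.
by rewrite -big_mkcond /= sumr_const -mulrnA.
Qed.

Lemma parseval_norm (T : finType) (x : T -> nat) : (forall i, x i < M)%N ->
  \sum_(t < M) normc (charsum x t) ^+ 2
    = (M * #|[pred p : T * T | x p.1 == x p.2]|)%:R.
Proof.
move=> hx; under eq_bigr do rewrite normc_sqr.
by rewrite -Re_sum parseval// -[_%:R]/(_%:R) -(rmorph_nat (real_complex R)).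
Qed.

(** The left side is an inner product of the sum with its product by a unimodular
    character, hence at most the squared norm.  This is what makes counts with a
    shifted difference no larger than the unshifted mean. *)
Lemma shifted_count (T : finType) (x : T -> nat) (d : nat) :
  (forall i, x i + d < M)%N ->
  (M * #|[pred p : T * T | (x p.1 + d)%N == x p.2]|)%:R
    <= \sum_(t < M) normc (charsum x t) ^+ 2.
Proof.
move=> hx; have hx' i : (x i < M)%N by apply: leq_ltn_trans (hx i); exact: leq_addr.
have /(congr1 (@complex.Re R)) := parseval hx hx'.
rewrite -(rmorph_nat (real_complex R)) /= => <-.
rewrite Re_sum; apply: ler_sum => t _; apply: le_trans (Re_mul_conj_le _ _) _.
have -> : charsum (fun i => x i + d)%N t = charsum x t * character d t.
  by rewrite /charsum mulr_suml; apply: eq_bigr => i _; rewrite characterD.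
by rewrite normcM normc_character mulr1; lra.
Qed.

(** Expand the square: only pairs of neighbouring indices survive, and each
    inner product is at most the average of the two squared norms. *)
Lemma almost_orthogonal (q : nat) (X : 'I_q -> 'I_M -> R[i]) :
  (forall i j : 'I_q, far i j ->
     \sum_(t < M) X i t * conjc (X j t) = 0) ->
  \sum_(t < M) normc (\sum_i X i t) ^+ 2
    <= 3 * \sum_i \sum_(t < M) normc (X i t) ^+ 2.
Proof.
move=> orth.
pose near (i j : 'I_q) := ~~ far i j.
pose n2 i := \sum_(t < M) normc (X i t) ^+ 2.
have n2_ge0 i : 0 <= n2 i by apply: sumr_ge0 => t _; exact: sqr_ge0.
have near_card (i : 'I_q) : (#|near i| <= 3)%N by exact: card_not_far.
apply: (@le_trans _ _ (\sum_i \sum_(j | near i j) (n2 i / 2 + n2 j / 2))).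
  under eq_bigr do rewrite normc_sqr_sum.
  rewrite exchange_big; apply: ler_sum => i _.
  rewrite exchange_big /= [leRHS]big_mkcond; apply: ler_sum => j _ /=.
  case: ifPn => [_|]; last by rewrite negbK => /orth h; rewrite -Re_sum h.
  rewrite -mulrDl -big_split /= mulr_suml; apply: ler_sum => t _.
  exact: Re_mul_conj_le.
have sym : \sum_i \sum_(j | near i j) n2 j / 2 = \sum_i \sum_(j | near i j) n2 i / 2.
  rewrite (exchange_big_dep predT)//=; apply: eq_bigr => i _.
  by apply: eq_bigl => j; rewrite /near /far orbC.
under eq_bigr do rewrite big_split/=.
rewrite big_split/= sym -big_split/= mulr_sumr; apply: ler_sum => i _.
rewrite -big_split/= -splitr sumr_const.
by rewrite -[leLHS]mulr_natl; apply: ler_wpM2r => //; rewrite ler_nat; exact: near_card.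
Qed.


End Characters.

(** * Transversality of the two equations *)

Section Transversality.
Variable R : realFieldType.
Implicit Types x y : R.

Definition chord n x y : R := \sum_(i < n) x ^+ i * y ^+ (n.-1 - i).

Lemma chordE n x y : x ^+ n - y ^+ n = (x - y) * chord n x y.
Proof.
rewrite subrXX; congr (_ * _); rewrite /chord (reindex_inj rev_ord_inj)/=.
by apply: eq_bigr => i _; case: n i => [[]//|n] i /=; rewrite subSS subKn// -ltnS.
Qed.

Lemma chord_sym n x y :
  2 * chord n x y =
    \sum_(i < n) (x ^+ i * y ^+ (n.-1 - i) + x ^+ (n.-1 - i) * y ^+ i).
Proof.
rewrite big_split/= -/(chord n x y) mulr_natl mulr2n; congr (_ + _).
rewrite /chord [RHS](reindex_inj rev_ord_inj)/=.
by apply: eq_bigr => i _; case: n i => [[]//|n] i /=; rewrite subSS subKn// -ltnS.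
Qed.

(** For [x] and [y] close the sum is about [n.+2 * y ^ n.+1].  The point of the
    factor [x + y] is that it also divides [x ^ 2 - y ^ 2], so that the bound
    compares increments of [t ^ n.+2] with increments of [t ^ 2]. *)
Lemma chord_ge n x y : 0 <= y <= x ->
  n.+2%:R * ((x + y) * y ^+ n) <= 2 * chord n.+2 x y.
Proof.
move=> /andP[y0 yx]; have x0 : 0 <= x by exact: le_trans yx.
rewrite chord_sym mulr_natl -[X in _ *+ X]card_ord -sumr_const.
apply: ler_sum => -[i /= hi] _; rewrite ltnS in hi.
have mono a b : (a + b = n.+1)%N -> y ^+ n.+1 <= x ^+ a * y ^+ b.
  move=> <-; rewrite exprD ler_wpM2r ?exprn_ge0//.
  by rewrite lerXn2r// nnegrE.
have mono1 a b : (a + b = n)%N -> x * y ^+ n <= x ^+ a.+1 * y ^+ b.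
  move=> <-; rewrite exprS -mulrA ler_wpM2l// exprD ler_wpM2r ?exprn_ge0//.
  by rewrite lerXn2r// nnegrE.
rewrite mulrDl -exprS; case: i hi => [|i] hi.
  by rewrite subn0 addrC lerD ?mono ?mono1//; lia.
by rewrite lerD ?mono ?mono1//; lia.
Qed.

Lemma chord_le n x y : 0 <= y <= x ->
  2 * chord n.+2 x y <= n.+2%:R * ((x + y) * x ^+ n).
Proof.
move=> /andP[y0 yx]; have x0 : 0 <= x by exact: le_trans yx.
rewrite chord_sym mulr_natl -[X in _ *+ X]card_ord -sumr_const.
apply: ler_sum => -[i /= hi] _; rewrite ltnS in hi.
have mono a b : (a + b = n.+1)%N -> x ^+ a * y ^+ b <= x ^+ n.+1.
  move=> <-; rewrite exprD ler_wpM2l ?exprn_ge0//.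
  by rewrite lerXn2r// nnegrE.
have mono1 a b : (a + b = n)%N -> x ^+ a * y ^+ b.+1 <= y * x ^+ n.
  move=> <-; rewrite exprSr mulrA mulrC ler_wpM2l// exprD ler_wpM2l ?exprn_ge0//.
  by rewrite lerXn2r// nnegrE.
rewrite mulrDl -exprS; have [E|hin] := eqVneq i n.+1.
  by rewrite E subnn addrC addrC lerD ?mono ?mono1//; lia.
have -> : (n.+1 - i = (n - i).+1)%N by lia.
by rewrite addrC lerD ?mono ?mono1//; lia.
Qed.

Lemma subX_le n x y : 0 <= y <= x ->
  x ^+ n.+1 - y ^+ n.+1 <= n.+1%:R * ((x - y) * x ^+ n).
Proof.
move=> /andP[y0 yx]; have x0 : 0 <= x by exact: le_trans yx.
rewrite chordE mulrCA ler_wpM2l ?subr_ge0//.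
rewrite mulr_natl -[X in _ *+ X]card_ord -sumr_const.
apply: ler_sum => -[i /= hi] _.
have {2}-> : (n = i + (n - i))%N by lia.
by rewrite exprD ler_wpM2l ?exprn_ge0// lerXn2r// nnegrE.
Qed.

Lemma bernoulli n x y : 0 <= y <= x ->
  n.+1%:R * ((x - y) * y ^+ n) <= x ^+ n.+1 - y ^+ n.+1.
Proof.
move=> /andP[y0 yx]; have x0 : 0 <= x by exact: le_trans yx.
rewrite chordE mulrCA ler_wpM2l ?subr_ge0//.
rewrite mulr_natl -[X in _ *+ X]card_ord -sumr_const.
apply: ler_sum => -[i /= hi] _.
have {1}-> : (n = i + (n - i))%N by lia.
by rewrite exprD ler_wpM2r ?exprn_ge0// lerXn2r// nnegrE.
Qed.

(** Taylor's inequality of order two, by applying the first-order bounds to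
    [x ^ n.+2] and then to the error [x ^ n.+1 - y ^ n.+1]. *)
Lemma tangent_error n x y : 0 <= y <= x ->
  0 <= x ^+ n.+2 - y ^+ n.+2 - n.+2%:R * ((x - y) * y ^+ n.+1)
    <= n.+2%:R * n.+1%:R * ((x - y) ^+ 2 * x ^+ n).
Proof.
move=> xy; have lo := bernoulli n.+1 xy; have hi := subX_le n.+1 xy.
have hi' := subX_le n xy; move: xy => /andP[y0 yx].
rewrite subr_ge0 lo/=; apply: (@le_trans _ _
  (n.+2%:R * ((x - y) * (x ^+ n.+1 - y ^+ n.+1)))).
  by rewrite mulrBr mulrBr lerD2r.
rewrite -mulrA ler_wpM2l// expr2 -mulrA mulrCA ler_wpM2l ?subr_ge0//.
Qed.

Lemma subX_ge n x y : 0 <= y <= x ->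
  (x - y) * x ^+ n <= x ^+ n.+1 - y ^+ n.+1.
Proof.
move=> /andP[y0 yx]; have x0 : 0 <= x by exact: le_trans yx.
rewrite mulrBl -exprS lerD2l lerN2 exprS ler_wpM2l//.
by rewrite lerXn2r// nnegrE.
Qed.

(** The combination of the two equations of the system whose derivative
    vanishes at [c]. *)
Definition flat j c t : R := 2 * t ^+ j.+3 - j.+3%:R * c ^+ j.+1 * t ^+ 2.

Lemma flat_sub j c x y :
  flat j c x - flat j c y
    = (x - y) * (2 * chord j.+3 x y - j.+3%:R * ((x + y) * c ^+ j.+1)).
Proof.
have := chordE j.+3 x y; rewrite /flat => E.
transitivity (2 * (x ^+ j.+3 - y ^+ j.+3)
   - j.+3%:R * c ^+ j.+1 * (x ^+ 2 - y ^+ 2)); first ring.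
rewrite E; ring.
Qed.

(** The combination is stationary at [c], so it varies quadratically nearby. *)
Lemma flat_small j c x l X : 0 <= c <= x -> x <= c + l -> x <= X ->
  0 <= flat j c x - flat j c c <= j.+3%:R * (2 * j.+1%:R * X ^+ j.+1 * l ^+ 2).
Proof.
move=> /[dup] cx' /andP[c0 cx] xl xX; rewrite flat_sub.
have lo := chord_ge j.+1 cx'; have hi := chord_le j.+1 cx'.
have x0 : 0 <= x by exact: le_trans cx.
have xc0 : 0 <= x - c by rewrite subr_ge0.
apply/andP; split; first by rewrite mulr_ge0// subr_ge0.
have h1 := subX_le j cx'.
apply: (@le_trans _ _ ((x - c) * (j.+3%:R * ((x + c) * (x ^+ j.+1 - c ^+ j.+1))))).
  rewrite ler_wpM2l// lerBlDr; apply: le_trans hi _.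
  by rewrite -mulrDr ler_wpM2l ?ler0n// -mulrDr subrK.
rewrite mulrCA ler_wpM2l//.
apply: (@le_trans _ _ (l * (2 * X * (j.+1%:R * (l * X ^+ j))))); last first.
  by rewrite exprS expr2; lra.
have xl' : x - c <= l by rewrite lerBlDl.
have l0 : 0 <= l by exact: le_trans xl'.
have X0 : 0 <= X by exact: le_trans xX.
have d0 : 0 <= x ^+ j.+1 - c ^+ j.+1.
  by rewrite subr_ge0 lerXn2r// nnegrE.
apply: ler_pM => //; first by rewrite mulr_ge0// addr_ge0.
apply: ler_pM => //; first by rewrite addr_ge0.
  by lra.
apply: le_trans h1 _; rewrite ler_wpM2l ?ler0n//.
apply: ler_pM => //; first by rewrite exprn_ge0.
by rewrite lerXn2r// nnegrE.
Qed.

(** Away from [c] on either side its slope is at least proportional to the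
    distance [D]. *)
Lemma flat_steep j c x y Y D : 0 <= Y -> 0 <= D -> Y <= c -> Y <= y -> y <= x ->
  c + D <= y \/ x <= c - D ->
  (x - y) * (j.+3%:R * (2 * D * Y ^+ j.+1)) <= `|flat j c x - flat j c y|.
Proof.
move=> Y0 D0 Yc Yy yx sep; rewrite flat_sub normrM (ger0_norm (x := x - y)) ?subr_ge0//.
rewrite ler_wpM2l ?subr_ge0//.
have y0 : 0 <= y by exact: le_trans Yy.
have c0 : 0 <= c by exact: le_trans Yc.
have x0 : 0 <= x by exact: le_trans yx.
have yx' : 0 <= y <= x by rewrite y0.
have main (u v : R) : Y <= u -> u + D <= v ->
    2 * D * Y ^+ j.+1 <= (x + y) * (v ^+ j.+1 - u ^+ j.+1).
  move=> Yu uv.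
  have u0 : 0 <= u by exact: le_trans Yu.
  have v0 : 0 <= v by apply: le_trans uv; rewrite addr_ge0.
  have uv' : 0 <= u <= v by rewrite u0 (le_trans _ uv)// lerDl.
  apply: (@le_trans _ _ (2 * Y * (D * Y ^+ j))); first by rewrite exprS; lra.
  apply: ler_pM => //; rewrite ?mulr_ge0 ?exprn_ge0//; first by lra.
  apply: le_trans (subX_ge j uv'); apply: ler_pM => //; rewrite ?exprn_ge0//; first lra.
  by rewrite lerXn2r// ?nnegrE//; lra.
case: sep => [cy|xc].
  have h := main _ _ Yc cy.
  rewrite ler_normr; apply/orP; left; rewrite lerBrDr.
  apply: le_trans (chord_ge j.+1 yx').
  by rewrite -mulrDr ler_wpM2l ?ler0n//; lra.
have h : 2 * D * Y ^+ j.+1 <= (x + y) * (c ^+ j.+1 - x ^+ j.+1).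
  by apply: main; lra.
rewrite ler_normr; apply/orP; right; rewrite opprB lerBrDr.
apply: le_trans (_ : _ <= j.+3%:R * (2 * D * Y ^+ j.+1) + j.+3%:R * ((x + y) * x ^+ j.+1)) _.
  by rewrite lerD2l; exact: chord_le.
by rewrite -mulrDr ler_wpM2l ?ler0n//; lra.
Qed.

(** The value of [flat j c] summed with signs over the six variables is twice the
    defect of the k-th powers, the quadratic parts cancelling.  Four variables lie
    in a window of length [l] starting at [c], where [flat] hardly varies, so the
    two others, at distance [D] from [c] where [flat] is steep, must be close to
    each other. *)
Lemma transversality j (Y X D l H c x y n1 n2 n3 n4 : R) :
  0 <= Y -> 0 <= D -> Y <= c -> Y <= y -> y <= x ->
  c + D <= y \/ x <= c - D ->
  (forall n, n \in [:: n1; n2; n3; n4] -> c <= n <= c + l /\ n <= X) ->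
  x ^+ 2 + n1 ^+ 2 + n2 ^+ 2 = y ^+ 2 + n3 ^+ 2 + n4 ^+ 2 ->
  `|(x ^+ j.+3 + n1 ^+ j.+3 + n2 ^+ j.+3) - (y ^+ j.+3 + n3 ^+ j.+3 + n4 ^+ j.+3)| <= H ->
  (x - y) * (j.+3%:R * (2 * D * Y ^+ j.+1))
    <= 2 * H + 2 * (j.+3%:R * (2 * j.+1%:R * X ^+ j.+1 * l ^+ 2)).
Proof.
move=> Y0 D0 Yc Yy yx sep hn E2 Ek.
apply: le_trans (flat_steep j Y0 D0 Yc Yy yx sep) _.
have c0 : 0 <= c by exact: le_trans Yc.
have bd n : n \in [:: n1; n2; n3; n4] ->
  0 <= flat j c n - flat j c c <= j.+3%:R * (2 * j.+1%:R * X ^+ j.+1 * l ^+ 2).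
  move=> /hn [/andP[cn nl] nX]; apply: flat_small => //; first by rewrite c0.
set U := j.+3%:R * _ in bd *.
have /andP[a1 b1] := bd n1 ltac:(by rewrite !inE eqxx ?orbT).
have /andP[a2 b2] := bd n2 ltac:(by rewrite !inE eqxx ?orbT).
have /andP[a3 b3] := bd n3 ltac:(by rewrite !inE eqxx ?orbT).
have /andP[a4 b4] := bd n4 ltac:(by rewrite !inE eqxx ?orbT).
have E : flat j c x + flat j c n1 + flat j c n2
   - (flat j c y + flat j c n3 + flat j c n4)
   = 2 * ((x ^+ j.+3 + n1 ^+ j.+3 + n2 ^+ j.+3)
          - (y ^+ j.+3 + n3 ^+ j.+3 + n4 ^+ j.+3)).
  have : j.+3%:R * c ^+ j.+1 * (x ^+ 2 + n1 ^+ 2 + n2 ^+ 2)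
    = j.+3%:R * c ^+ j.+1 * (y ^+ 2 + n3 ^+ 2 + n4 ^+ 2) by rewrite E2.
  by rewrite /flat; lra.
move: Ek; rewrite !ler_norml => /andP[k1 k2]; apply/andP; split; lra.
Qed.

End Transversality.

(** * Pointwise inequalities *)

Section Pointwise.
Variable R : realType.

Lemma cauchy_schwarz (I : finType) (x y : I -> R) :
  (\sum_i x i * y i) ^+ 2 <= (\sum_i x i ^+ 2) * (\sum_i y i ^+ 2).
Proof.
have h : 0 <= \sum_i \sum_j (x i * y j - x j * y i) ^+ 2.
  by apply: sumr_ge0 => i _; apply: sumr_ge0 => j _; exact: sqr_ge0.
suff E : \sum_i \sum_j (x i * y j - x j * y i) ^+ 2 =
  2 * ((\sum_i x i ^+ 2) * (\sum_i y i ^+ 2) - (\sum_i x i * y i) ^+ 2).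
  by rewrite E in h; lra.
transitivity (\sum_i (x i ^+ 2 * (\sum_j y j ^+ 2) + y i ^+ 2 * (\sum_j x j ^+ 2)
    - 2 * (x i * y i) * \sum_j (x j * y j))).
  apply: eq_bigr => i _; rewrite !mulr_sumr -sumrN -!big_split/=.
  by apply: eq_bigr => j _; ring.
rewrite sumrB big_split/= -!mulr_suml -mulr_sumr; ring.
Qed.

(** Hoelder's inequality for integer exponents, by induction on the exponent. *)
Lemma power_mean_sum n (q : nat) (u : 'I_q -> R) : (forall i, 0 <= u i) ->
  (\sum_i u i) ^+ n.+1 <= q%:R ^+ n * \sum_i u i ^+ n.+1.
Proof.
move=> u0; elim: n => [|n IH]; first by rewrite !expr1 expr0 mul1r.
have S0 : 0 <= \sum_i u i by exact: sumr_ge0.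
rewrite exprS; apply: (@le_trans _ _ ((\sum_i u i) * (q%:R ^+ n * \sum_i u i ^+ n.+1))).
  by rewrite ler_wpM2l.
rewrite mulrCA exprSr -mulrA ler_wpM2l ?exprn_ge0 ?ler0n//.
rewrite mulr_suml.
(* Chebyshev's sum inequality *)
suff : 0 <= \sum_i \sum_j (u i - u j) * (u i ^+ n.+1 - u j ^+ n.+1).
  have -> : \sum_i \sum_j (u i - u j) * (u i ^+ n.+1 - u j ^+ n.+1) =
    2 * (q%:R * \sum_i u i ^+ n.+2 - \sum_i u i * \sum_j u j ^+ n.+1).
    transitivity (\sum_i (q%:R * u i ^+ n.+2 + \sum_j u j ^+ n.+2
       - (u i * \sum_j u j ^+ n.+1 + u i ^+ n.+1 * \sum_j u j))).
      apply: eq_bigr => i _; rewrite !mulr_sumr -!big_split/= -sumrN.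
      rewrite -[q in q%:R]card_ord mulr_natl -sumr_const -!big_split/=.
      by apply: eq_bigr => j _; rewrite !exprS; ring.
    rewrite sumrB !big_split/= sumr_const card_ord -[X in _ + X - _]mulr_natl.
    rewrite -mulr_sumr -!mulr_suml; ring.
  lra.
apply: sumr_ge0 => i _; apply: sumr_ge0 => j _.
wlog ij : i j / u i <= u j.
  move=> H; have [|/ltW] := leP (u i) (u j); first exact: H.
  by move=> /H; rewrite -mulrNN !opprB.
rewrite -mulrNN !opprB mulr_ge0// subr_ge0// lerXn2r// nnegrE; exact: u0.
Qed.

(** Compare all terms with the largest one, of index [i0].  If every term far from
    [i0] is smaller by a factor [q], the at most three near terms dominate and the
    sum is at most four times the largest term.  Otherwise a far term is at least
    a [q]-th of the largest, and their product controls the sum. *)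
Lemma broad_narrow (q : nat) (X : 'I_q -> R[i]) : (0 < q)%N ->
  normc (\sum_i X i) ^+ 6 <= 4 ^+ 6 * (\sum_i normc (X i) ^+ 6)
    + q%:R ^+ 9 * \sum_i \sum_(j | far i j) normc (X i) ^+ 3 * normc (X j) ^+ 3.
Proof.
move=> q0; pose u i := normc (X i).
have u0 i : 0 <= u i by exact: normc_ge0.
have [i0 i0max] : exists i0, forall i, u i <= u i0.
  case: (@arg_maxP _ _ _ (Ordinal q0) predT u isT) => i0 _ h.
  by exists i0 => i; exact: h.
have q0' : 0 < q%:R :> R by rewrite ltr0n.
have sum_le : normc (\sum_i X i) <= \sum_i u i by exact: normc_sum.
have nar0 : 0 <= \sum_i u i ^+ 6 by apply: sumr_ge0 => i _; rewrite exprn_ge0.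
have bro0 : 0 <= \sum_i \sum_(j | far i j) u i ^+ 3 * u j ^+ 3.
  by do 2 (apply: sumr_ge0 => ? _); rewrite mulr_ge0 ?exprn_ge0 ?normc_ge0.
have [/existsP[j /andP[fj hj]]|/existsPn hn] :=
  boolP [exists j : 'I_q, far i0 j && (u i0 < q%:R * u j)].
  apply: (@le_trans _ _ (q%:R ^+ 9 * (u i0 ^+ 3 * u j ^+ 3))); last first.
    apply: ler_wpDl; first by rewrite mulr_ge0 ?exprn_ge0 ?normc_ge0.
    rewrite ler_wpM2l ?exprn_ge0 ?ler0n//.
    rewrite (bigD1 i0)//= (bigD1 j)//= -addrA lerDl addr_ge0//.
      by apply: sumr_ge0 => ? _; rewrite mulr_ge0 ?exprn_ge0 ?normc_ge0.
    by do 2 (apply: sumr_ge0 => ? _); rewrite mulr_ge0 ?exprn_ge0 ?normc_ge0.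
  have le1 : normc (\sum_i X i) <= q%:R * u i0.
    apply: le_trans sum_le _; rewrite mulr_natl -[X in _ *+ X]card_ord -sumr_const.
    exact: ler_sum.
  apply: (@le_trans _ _ ((q%:R * u i0) ^+ 6)).
    by rewrite lerXn2r// nnegrE ?normc_ge0// mulr_ge0.
  have h3 : u i0 ^+ 3 <= (q%:R * u j) ^+ 3 by rewrite lerXn2r ?nnegrE ?mulr_ge0// ltW.
  have -> : q%:R ^+ 9 * (u i0 ^+ 3 * u j ^+ 3) = q%:R ^+ 6 * u i0 ^+ 3 * (q%:R * u j) ^+ 3.
    by rewrite exprMn; ring.
  have -> : (q%:R * u i0) ^+ 6 = q%:R ^+ 6 * u i0 ^+ 3 * u i0 ^+ 3 by rewrite exprMn; ring.
  by rewrite ler_wpM2l// mulr_ge0 ?exprn_ge0// ltW.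
have le1 : normc (\sum_i X i) <= 4 * u i0.
  apply: le_trans sum_le _; rewrite (bigID (far i0))/=.
  have -> : 4 * u i0 = u i0 + 3 * u i0 by ring.
  apply: lerD.
    apply: (@le_trans _ _ (\sum_(i < q) u i0 / q%:R)); last first.
      by rewrite sumr_const card_ord -[leLHS]mulr_natr divfK// gt_eqF.
    rewrite big_mkcond/=; apply: ler_sum => i _; case: ifP => fi.
      by have := hn i; rewrite fi/= -leNgt ler_pdivlMr// mulrC.
    by rewrite divr_ge0// ltW.
  apply: (@le_trans _ _ (\sum_(i < q | ~~ far i0 i) u i0)); first exact: ler_sum.
  rewrite sumr_const -[leLHS]mulr_natl; apply: ler_wpM2r => //.
  by rewrite ler_nat; exact: card_not_far.
apply: (@le_trans _ _ (4 ^+ 6 * u i0 ^+ 6)).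
  by rewrite -exprMn lerXn2r// nnegrE ?normc_ge0// mulr_ge0.
apply: ler_wpDr; first by rewrite mulr_ge0 ?exprn_ge0 ?ler0n.
rewrite ler_wpM2l// (bigD1 i0)//= lerDl.
by apply: sumr_ge0 => ? _; rewrite exprn_ge0 ?normc_ge0.
Qed.

End Pointwise.

(** * The bootstrap inequality *)

(** The hypotheses of this section are the inequalities between [lin q c], read as
    [a(q) <= c], and [bil p alpha beta c], read as [b(alpha, beta) <= c] for
    windows of ambient length [r s^p]; [S] stands for [s].  They are abstracted
    from the exponential sums because the rest is a computation with exponents. *)
Section Bootstrap.
Variables (R : realFieldType) (S : R).
Variables (lin : nat -> R -> Prop) (bil : nat -> nat -> nat -> R -> Prop).
Hypothesis S1 : 1 <= S.
Hypothesis lin0 : lin 0 1.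
Hypothesis lin_le : forall q c c', c <= c' -> lin q c -> lin q c'.
Hypothesis bil_le : forall p a b c c', c <= c' -> bil p a b c -> bil p a b c'.
Hypothesis lin_succ : forall q c, lin q c -> lin q.+1 (S ^+ 3 * c).
Hypothesis lin_broad_narrow : forall p c1 c2, 0 <= c1 -> 0 <= c2 ->
  lin p c1 -> bil p.+1 1 1 c2 -> lin p.+1 (c1 / 4 + S ^+ 8 * c2).
Hypothesis lin_bil : forall p a b c,
  lin (p - a) c -> lin (p - b) c -> bil p a b (2 * c).
Hypothesis bil_refine : forall p a b c, (0 < a)%N -> (a <= b.*2.-2)%N ->
  (b.*2.-2 <= p)%N -> bil p b.*2.-2 b c -> bil p a b (3 * c).
Hypothesis bil_swap : forall p a b c c1 c2, 0 <= c -> c1 * c2 <= c ^+ 2 ->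
  bil p b a c1 -> lin (p - b) c2 -> bil p a b c.
Hypothesis bil_shrink : forall p a b b' c, (b <= b' <= p)%N ->
  bil p a b' c -> bil p a b (S ^+ (2 * (b' - b)) * c).

Section Chain.
Variables (C sigma : R) (n p g : nat).
Hypothesis C1 : 1 <= C.
Hypothesis sigma1 : 1 <= sigma.
Hypothesis linC : forall q, lin q (C * sigma ^+ q).
Hypothesis hp : (2 ^ n.+2 * g + 2 <= p)%N.

(* Chosen so that [2 beta - 2] is the next term: the sequence [beta - 2] doubles. *)
Let beta i := (2 ^ i.+1 * g + 2)%N.

Let betaS i : (beta i).*2.-2 = beta i.+1.
Proof. by rewrite /beta [(2 ^ i.+2)%N]expnS; lia. Qed.

Let beta_mono i i' : (i <= i')%N -> (beta i <= beta i')%N.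
Proof. by move=> ii; rewrite /beta leq_add2r leq_mul2r leq_exp2l ?orbT// ltnS ii orbT. Qed.

(** Descending induction on [i]: one round consists of refining the first window,
    then exchanging the roles of the two windows.  With exponents
    [c_i = 2 ^ i * g * (2 + n - i)] the square root in the exchange step takes
    the mean of [c_(i+1)] and [beta i], which is at least [c_i]. *)
Lemma bil_chain d i : (i + d = n)%N ->
  bil p (beta i.+1) (beta i) (3 * C * sigma ^+ (p - 2 ^ i * g * (2 + d))).
Proof.
elim: d i => [|d IH] i hi.
  rewrite addn0 in hi; subst i; set u := (p - _)%N.
  have -> : 3 * C * sigma ^+ u = 2 * (3 / 2 * C * sigma ^+ u) by field.
  have L v : (v <= u)%N -> lin v (3 / 2 * C * sigma ^+ u).
    move=> vu; apply: lin_le (linC v).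
    have := ler_weXn2l sigma1 vu.
    have : 0 <= sigma ^+ v by rewrite exprn_ge0// (le_trans ler01).
    by move: C1; nra.
  apply: lin_bil; apply: L; rewrite /u /beta.
    by rewrite [(2 ^ n.+2)%N]expnS [(2 ^ n.+1)%N]expnS; lia.
  by rewrite [(2 ^ n.+1)%N]expnS; lia.
have {}IH : bil p (beta i.+2) (beta i.+1) (3 * C * sigma ^+ (p - 2 ^ i.+1 * g * (2 + d))).
  by apply: IH; lia.
have bp : (beta i.+2 <= p)%N.
  apply: leq_trans hp; rewrite /beta leq_add2r leq_mul2r leq_exp2l//; lia.
have h1 : bil p (beta i) (beta i.+1) (3 * (3 * C * sigma ^+ (p - 2 ^ i.+1 * g * (2 + d)))).
  by apply: bil_refine; rewrite ?betaS ?beta_mono//; [rewrite /beta addn2|lia].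
apply: (bil_swap _ _ h1 (linC _)).
  by rewrite !mulr_ge0 ?exprn_ge0//; move: C1 sigma1; lra.
rewrite !exprMn -exprM.
set x := (p - 2 ^ i.+1 * _ * _)%N; set y := (p - beta i)%N; set z := ((p - _) * 2)%N.
have xyz : (x + y <= z)%N.
  have tw e : (2 + e <= 2 ^ e.+1)%N by elim: e => // e he; rewrite expnS; lia.
  have le_p i' e : (i' + e = n)%N -> (2 ^ i' * g * (2 + e) <= p)%N.
    move=> ie; apply: (@leq_trans (2 ^ n.+2 * g)); last by lia.
    rewrite mulnAC; apply: leq_mul => //.
    have -> : (2 ^ n.+2 = 2 ^ i' * 2 ^ e.+2)%N by rewrite -expnD; congr (_ ^ _)%N; lia.
    by apply: leq_mul => //; apply: leq_trans (tw e) _; rewrite leq_exp2l.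
  have := le_p _ _ hi; have := le_p i.+1 d; rewrite addSnnS => /(_ hi).
  move: bp; rewrite /x /y /z /beta !expnS; move: (2 ^ i)%N => e; clear.
  have -> : (2 * (2 * (2 * e)) * g = 8 * (e * g))%N by ring.
  rewrite -(mulnA 2%N e g) -(mulnA 2%N (e * g)%N).
  by move: (e * g)%N => a; rewrite !mulnDr !mulnS; move: (a * d)%N => b; lia.
have -> : 3 * (3 * C * sigma ^+ x) * (C * sigma ^+ y) = 3 ^+ 2 * C ^+ 2 * sigma ^+ (x + y).
  by rewrite exprD; ring.
rewrite ler_wpM2l ?ler_weXn2l//.
by rewrite mulr_ge0// exprn_ge0//; move: C1; lra.
Qed.

Lemma bil11_chain :
  bil p 1 1 (S ^+ (2 * (2 * g + 1)) * (3 * (3 * C * sigma ^+ (p - g * (2 + n))))).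
Proof.
have := bil_chain (add0n n); rewrite expn0 mul1n -(betaS 0) => h.
have -> : (2 * (2 * g + 1) = 2 * (beta 0 - 1))%N by rewrite /beta expn1; lia.
have b0p : (beta 0 <= beta 1 <= p)%N.
  by rewrite beta_mono//=; apply: leq_trans hp; rewrite /beta leq_add2r leq_mul2r leq_exp2l// orbT.
have beta0 i : (0 < beta i)%N by rewrite /beta addn2.
case/andP: b0p => h1 h2; apply: bil_shrink; first by rewrite beta0 (leq_trans h1).
by apply: bil_refine => //; rewrite betaS.
Qed.

End Chain.

(** Start the chain at [beta = 2 g + 2] with [g] about [p / 2 ^ n.+2].  Shrinking the
    windows to that size costs [S ^ (4 g + 2)], the chain gains
    [sigma ^ (g (n + 2)) >= S ^ (5 g)], and the net gain [S ^ g] is about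
    [theta ^ p].  The narrow term of [lin_broad_narrow] is absorbed by induction
    on the length. *)
Lemma bootstrap_step C sigma theta n : 1 <= C -> 1 <= theta -> theta <= sigma ->
  theta ^+ (2 ^ n.+2) = S -> S ^+ 5 <= sigma ^+ n.+2 ->
  (forall q, lin q (C * sigma ^+ q)) ->
  forall p, lin p (36 * S ^+ 13 * C * (sigma / theta) ^+ p).
Proof.
move=> C1 th1 ths thS Ss linC.
have S0 : 0 < S by exact: lt_le_trans S1.
have th0 : 0 < theta by exact: lt_le_trans th1.
have sg1 : 1 <= sigma by exact: le_trans ths.
have sg0 : 0 < sigma by exact: lt_le_trans sg1.
have C0 : 0 < C by exact: lt_le_trans C1.
set tau := sigma / theta.
have tau1 : 1 <= tau by rewrite ler_pdivlMr// mul1r.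
have tau0 : 0 <= tau by exact: le_trans tau1.
have SX a b : (a <= b)%N -> S ^+ a <= S ^+ b by move=> ab; exact: ler_weXn2l.
have S13 : 1 <= S ^+ 13 by rewrite -[1](expr0 S) SX.
have bil2 p : bil p.+2 1 1 (9 * C * S ^+ 5 * tau ^+ p.+2).
  pose g := (p %/ 2 ^ n.+2)%N.
  have hp : (2 ^ n.+2 * g + 2 <= p.+2)%N.
    by rewrite addn2 !ltnS mulnC leq_divM.
  apply: bil_le (bil11_chain C1 sg1 linC hp).
  have le_p : (g * (2 + n) <= p.+2)%N.
    apply: leq_trans hp; rewrite mulnC; apply: (@leq_trans (2 ^ n.+2 * g)); last by rewrite leq_addr.
    by rewrite leq_mul2r; apply/orP; right; elim: (n) => // m hm; rewrite expnS; lia.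
  have p_lt : (p.+2 <= 2 ^ n.+2 * g.+1 + 2)%N.
    by rewrite addn2 !ltnS mulnC ltnW// ltn_ceil// expn_gt0.
  have thp : theta ^+ p.+2 <= S ^+ (g + 3).
    apply: (@le_trans _ _ (theta ^+ (2 ^ n.+2 * g.+1 + 2))); first exact: ler_weXn2l.
    have thS' : theta <= S by rewrite -thS -[leLHS]expr1 ler_weXn2l// expn_gt0.
    rewrite exprD exprM thS -[(g + 3)%N]addSnnS exprD ler_wpM2l ?exprn_ge0 ?(ltW S0)//.
    by rewrite lerXn2r// nnegrE ltW.
  have sgE : sigma ^+ (p.+2 - g * (2 + n)) * S ^+ (5 * g) <= sigma ^+ p.+2.
    rewrite -[in leRHS](subnK le_p) exprD ler_wpM2l ?exprn_ge0 ?(ltW sg0)//.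
    rewrite exprM mulnC exprM lerXn2r// ?nnegrE ?exprn_ge0 ?(ltW S0) ?(ltW sg0)//.
  rewrite /tau expr_div_n [leRHS]mulrA ler_pdivlMr ?exprn_gt0//.
  set sp := sigma ^+ (_ - _) in sgE *.
  have sp0 : 0 <= sp by rewrite exprn_ge0// ltW.
  apply: (@le_trans _ _ (9 * C * S ^+ 5 * (sp * S ^+ (5 * g)))); last first.
    by rewrite ler_wpM2l// !mulr_ge0 ?exprn_ge0 ?(ltW S0) ?(ltW C0).
  have -> : S ^+ (2 * (2 * g + 1)) * (3 * (3 * C * sp)) * theta ^+ p.+2
     = 9 * C * sp * (S ^+ (2 * (2 * g + 1)) * theta ^+ p.+2) by ring.
  have -> : 9 * C * S ^+ 5 * (sp * S ^+ (5 * g)) = 9 * C * sp * (S ^+ (2 * (2 * g + 1)) * S ^+ (g + 3)).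
    rewrite -exprD (_ : 2 * (2 * g + 1) + (g + 3) = 5 + 5 * g)%N; last by ring.
    by rewrite exprD; ring.
  by rewrite ler_wpM2l ?ler_wpM2l ?exprn_ge0 ?(ltW S0)// !mulr_ge0 ?(ltW C0).
have Sge0 m : 0 <= S ^+ m by rewrite exprn_ge0// ltW.
have C0' := ltW C0.
have tauX m : 0 <= tau ^+ m by rewrite exprn_ge0.
case=> [|p].
  by apply: lin_le lin0; rewrite expr0 mulr1; nra.
elim: p => [|p IH].
  apply: lin_le (lin_succ lin0); rewrite mulr1 expr1.
  apply: (@le_trans _ _ (S ^+ 13)); first exact: SX.
  have : 1 <= C * tau by rewrite -[1]mulr1 ler_pM.
  by move: S13; set x := _ ^+ 13; nra.
have c10 : 0 <= 36 * S ^+ 13 * C * tau ^+ p.+1.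
  by do 3?[apply: mulr_ge0 => //].
have c20 : 0 <= 9 * C * S ^+ 5 * tau ^+ p.+2.
  by do 3?[apply: mulr_ge0 => //].
apply: lin_le (lin_broad_narrow c10 c20 IH (bil2 p)).
have -> : S ^+ 8 * (9 * C * S ^+ 5 * tau ^+ p.+2) = 9 * S ^+ 13 * C * tau ^+ p.+2.
  by rewrite (_ : 13 = 8 + 5)%N// exprD; ring.
have h : tau ^+ p.+1 <= tau ^+ p.+2 by exact: ler_weXn2l.
have : S ^+ 13 * C * tau ^+ p.+1 <= S ^+ 13 * C * tau ^+ p.+2.
  by rewrite ler_wpM2l//; apply: mulr_ge0.
have : 0 <= S ^+ 13 * C * tau ^+ p.+2.
  by do 3?[apply: mulr_ge0 => //].
move: (tau ^+ p.+1) (tau ^+ p.+2) (S ^+ 13) => x y z; lra.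
Qed.

(** Iterate the improvement from the trivial value [S ^ 3], stopping at [sigma];
    the maximum with [sigma] keeps the hypothesis of the step valid, and since
    [theta ^ (2 ^ n.+2) = S] the number of steps is [3 * 2 ^ n.+2], whatever the
    instance. *)
Lemma bootstrap theta sigma n : 1 <= theta -> theta <= sigma ->
  theta ^+ (2 ^ n.+2) = S -> S ^+ 5 <= sigma ^+ n.+2 ->
  forall p, lin p ((36 * S ^+ 13) ^+ (3 * 2 ^ n.+2) * sigma ^+ p).
Proof.
move=> th1 ths thS Ss.
have S0 : 0 < S by exact: lt_le_trans S1.
have th0 : 0 < theta by exact: lt_le_trans th1.
have sg1 : 1 <= sigma by exact: le_trans ths.
pose sg i := Num.max sigma (S ^+ 3 / theta ^+ i).
have sg_ge i : sigma <= sg i by rewrite /sg le_max lexx.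
have D1 : 1 <= 36 * S ^+ 13.
  have : 1 <= S ^+ 13 by rewrite exprn_ege1.
  by move: (S ^+ 13) => x; lra.
have P i : forall q, lin q ((36 * S ^+ 13) ^+ i * sg i ^+ q).
  elim: i => [|i IH] q.
    rewrite expr0 mul1r /sg expr0 divr1.
    suff : lin q ((S ^+ 3) ^+ q).
      apply: lin_le; rewrite lerXn2r// ?nnegrE ?exprn_ge0 ?(ltW S0)//.
        by rewrite le_max exprn_ge0 ?orbT// ltW.
      by rewrite le_max lexx orbT.
    by elim: q => [|q IH]; [rewrite expr0|rewrite exprS; exact: lin_succ].
  have := bootstrap_step (exprn_ege1 i D1) th1 (le_trans ths (sg_ge i)) thS _ IH.
  have h : S ^+ 5 <= sg i ^+ n.+2.
    apply: le_trans Ss _; rewrite lerXn2r// ?nnegrE ?(le_trans _ sg1)//.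
    by rewrite (le_trans _ (sg_ge i))// (le_trans _ sg1).
  move=> /(_ h q); apply: lin_le; rewrite -exprS ler_wpM2l//.
    by rewrite exprn_ge0// (le_trans _ D1).
  have sgi0 : 0 <= sg i by rewrite (le_trans _ (sg_ge i))// (le_trans _ sg1).
  rewrite lerXn2r// ?nnegrE ?divr_ge0 ?(ltW th0)//.
    by rewrite (le_trans _ (sg_ge _))// (le_trans _ sg1).
  rewrite ler_pdivrMr// /sg; rewrite ge_max; apply/andP; split.
    apply: (@le_trans _ _ (Num.max sigma (S ^+ 3 / theta ^+ i.+1))).
      by rewrite le_max lexx.
    rewrite ler_peMr// le_max (le_trans _ sg1)//.
  apply: (@le_trans _ _ (S ^+ 3 / theta ^+ i.+1 * theta)).
    by rewrite le_eqVlt (exprS theta); apply/orP; left; apply/eqP; field; rewrite ?expf_neq0 ?gt_eqF.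
  by rewrite ler_wpM2r ?(ltW th0)// le_max lexx orbT.
have thE : theta ^+ (3 * 2 ^ n.+2) = S ^+ 3 by rewrite mulnC exprM thS.
move=> p; have := P (3 * 2 ^ n.+2)%N p.
by rewrite /sg thE divff ?expf_neq0 ?gt_eqF// (max_idPl sg1).
Qed.

End Bootstrap.

(** * Decoupling for the curve of squares and k-th powers *)

(** For [Q] larger than all sums of k-th powers in play, a coincidence of sums of
    frequencies is a coincidence of sums of squares and of sums of k-th powers. *)
Definition freq (k Q n : nat) : nat := n ^ k + Q * n ^ 2.

Lemma freq_separates (Q S1 S2 K1 K2 h1 h2 : nat) :
  (K1 + h1 < Q)%N -> (K2 + h2 < Q)%N ->
  (K1 + Q * S1 + h1 = K2 + Q * S2 + h2)%N ->
  S1 = S2 /\ (K1 + h1 = K2 + h2)%N.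
Proof.
move=> l1 l2 E; suff S12 : S1 = S2 by subst S2; split => //; lia.
have [s12|s12|//] := ltngtP S1 S2.
  have : (Q * S1.+1 <= Q * S2)%N by rewrite leq_mul2l s12 orbT.
  by rewrite mulnS; lia.
have : (Q * S2.+1 <= Q * S1)%N by rewrite leq_mul2l s12 orbT.
by rewrite mulnS; lia.
Qed.

Lemma sum3_lt (a b c h x H Q : nat) : (a <= x)%N -> (b <= x)%N -> (c <= x)%N ->
  (h < H)%N -> (3 * x + H < Q)%N -> (a + b + c + h < Q)%N.
Proof. lia. Qed.

Lemma dist_lt (a b g g' H : nat) : (a + g = b + g')%N -> (g < H)%N -> (g' < H)%N ->
  (b <= a + H)%N && (a <= b + H)%N.
Proof. lia. Qed.

Lemma freq_sum3 (a b c d e f h g Q a' b' c' d' e' f' : nat) :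
  (a + Q * a' + (b + Q * b' + (c + Q * c')) + h
    = d + Q * d' + (e + Q * e' + (f + Q * f')) + g ->
  a + b + c + Q * (a' + b' + c') + h = d + e + f + Q * (d' + e' + f') + g)%N.
Proof. rewrite !mulnDr; lia. Qed.

Lemma near_of_close m i i' l a a' : (a < l)%N -> (a' < l)%N ->
  (m + i * l + a <= m + i' * l + a' + l)%N -> (i <= i'.+1)%N.
Proof.
move=> al al' h; rewrite leqNgt; apply/negP => ii.
have : (i'.+2 * l <= i * l)%N by rewrite leq_mul2r ii orbT.
by rewrite !mulSn; lia.
Qed.

Lemma ord_block_lt q l (u : 'I_q) (b : 'I_l) : (u * l + b < q * l)%N.
Proof.
have : (u.+1 * l <= q * l)%N by rewrite leq_mul2r ltn_ord orbT.
by rewrite mulSn; have := ltn_ord b; lia.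
Qed.

Lemma freq_mono k Q x y : (x <= y)%N -> (freq k Q x <= freq k Q y)%N.
Proof.
move=> xy; rewrite /freq leq_add//; last by rewrite leq_mul ?leq_exp2r.
by case: k => [|k]; rewrite ?expn0// leq_exp2r.
Qed.

(** A coincidence modulo [M] of two sums of three frequencies, each augmented by an
    index below [H], is then an equality of integers ([freq k Q X < M / 3]) that
    separates into the two equations ([3 * X ^ k + H < Q]). *)
Definition no_carry k Q M H X :=
  (3 * X ^ k + H < Q)%N && (3 * freq k Q X + H < M)%N.

(** The inequality that turns the conclusion of [transversality], for a window of
    length [l] at distance [D], into the bound [lJ] on the distance between the two
    remaining points.  The windows used below satisfy [s * l ^ 2 = lJ * D]. *)
Definition resolves k H X Y s r := forall l lJ D, (r <= l)%N -> (s * l ^ 2 <= lJ * D)%N ->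
  (2 * H + 2 * (k * (2 * k.-2 * X ^ k.-2 * l ^ 2)) <= lJ * (k * (2 * D * Y ^ k.-2)))%N.

Lemma resolvesP k H X Y s r C kappa :
  (X <= kappa * Y)%N -> (H <= C * (Y ^ k.-2 * r ^ 2))%N ->
  (0 < k.-2)%N -> (C + 2 * k * k.-2 * kappa ^ k.-2 <= s)%N -> resolves k H X Y s r.
Proof.
move=> hX hH k2 hs l lJ D rl hl.
set n := k.-2 in hX hH hs k2 *.
have XY : (X ^ n <= kappa ^ n * Y ^ n)%N by rewrite -expnMn leq_exp2r.
have rL : (r ^ 2 <= l ^ 2)%N by rewrite leq_exp2r.
move: hH hs XY rL hl; move: (X ^ n)%N (Y ^ n)%N (kappa ^ n)%N (l ^ 2)%N (r ^ 2)%N.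
move=> x y z L rr hH hs XY rL hl.
have k0 : (0 < k)%N by rewrite /n in k2; case: (k) k2.
have hH' : (H <= C * (y * L))%N by apply: leq_trans hH _; rewrite !leq_mul.
have -> : (lJ * (k * (2 * D * y)) = (lJ * D) * (2 * k * y))%N by ring.
apply: leq_trans (leq_mul hl (leqnn _)).
have -> : (s * L * (2 * k * y) = s * (2 * k * (y * L)))%N by ring.
apply: leq_trans (leq_mul hs (leqnn _)); rewrite mulnDl; apply: leq_add.
  have -> : (C * (2 * k * (y * L)) = (2 * k) * (C * (y * L)))%N by ring.
  by rewrite leq_mul// leq_pmulr.
have -> : (2 * (k * (2 * n * x * L)) = (4 * k * n) * (x * L))%N by ring.
have -> : (2 * k * n * z * (2 * k * (y * L)) = (4 * k * n) * (z * y * (k * L)))%N by ring.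
by rewrite !leq_mul// leq_pmull.
Qed.

Section Decoupling.
Variables (R : realType) (j Q M H Y X : nat).
Local Notation k := j.+3.
Local Notation f := (freq k Q).
Hypothesis Y0 : (0 < Y)%N.
Hypothesis nc : no_carry k Q M H X.

Let M0 : (0 < M)%N. Proof. by case/andP: nc => _; case: M. Qed.

Definition window_sum (m l : nat) : 'I_M -> R[i] := charsum R (fun i : 'I_l => f (m + i)).

Definition window_norm m l (t : 'I_M) : R := normc (window_sum m l t).

(** Its squared modulus has Fourier coefficients [H - |d|] for [|d| < H] and [0]
    elsewhere: multiplying by it relaxes an equation to an inequality while
    keeping all counts nonnegative. *)
Definition dirichlet : 'I_M -> R[i] := charsum R (fun h : 'I_H => h : nat).

Definition mean (g : 'I_M -> R) : R := \sum_t g t * normc (dirichlet t) ^+ 2.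

Definition admissible m l := (Y <= m)%N && (m + l <= X)%N.

Lemma window_norm_ge0 m l t : 0 <= window_norm m l t.
Proof. exact: normc_ge0. Qed.

Lemma le_mean g1 g2 : (forall t, g1 t <= g2 t) -> mean g1 <= mean g2.
Proof. by move=> h; apply: ler_sum => t _; rewrite ler_wpM2r ?exprn_ge0 ?normc_ge0. Qed.

Lemma mean_ge0 g : (forall t, 0 <= g t) -> 0 <= mean g.
Proof. by move=> h; apply: sumr_ge0 => t _; rewrite mulr_ge0 ?exprn_ge0 ?normc_ge0. Qed.

Lemma meanD g1 g2 : mean (fun t => g1 t + g2 t) = mean g1 + mean g2.
Proof. by rewrite /mean -big_split/=; apply: eq_bigr => t _; rewrite mulrDl. Qed.

Lemma meanZ a g : mean (fun t => a * g t) = a * mean g.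
Proof. by rewrite /mean mulr_sumr; apply: eq_bigr => t _; rewrite mulrA. Qed.

Lemma mean_sum (I : finType) (P : pred I) (g : I -> 'I_M -> R) :
  mean (fun t => \sum_(i | P i) g i t) = \sum_(i | P i) mean (g i).
Proof. by rewrite /mean exchange_big; apply: eq_bigr => t _; rewrite mulr_suml. Qed.

Lemma mean_CS g1 g2 : mean (fun t => g1 t * g2 t) ^+ 2
  <= mean (fun t => g1 t ^+ 2) * mean (fun t => g2 t ^+ 2).
Proof.
have := cauchy_schwarz (fun t => g1 t * normc (dirichlet t)) (fun t => g2 t * normc (dirichlet t)).
rewrite /mean; congr (_ <= _).
  by congr (_ ^+ 2); apply: eq_bigr => t _; ring.
by congr (_ * _); apply: eq_bigr => t _; rewrite exprMn.
Qed.

Lemma window_sum_split m q l t : window_sum m (q * l) t = \sum_(i < q) window_sum (m + i * l) l t.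
Proof.
rewrite /window_sum /charsum; elim: q => [|q IH]; first by rewrite mul0n !big_ord0.
rewrite big_ord_recr/= -IH mulSnr big_split_ord/=; congr (_ + _).
by apply: eq_bigr => i _; rewrite addnA.
Qed.

Lemma admissible_sub m q l (i : 'I_q) : admissible m (q * l) -> admissible (m + i * l) l.
Proof.
move=> /andP[Ym mX]; rewrite /admissible (leq_trans Ym) ?leq_addr//=.
rewrite -addnA; apply: leq_trans mX; rewrite leq_add2l addnC -mulSn leq_mul2r.
by rewrite ltn_ord orbT.
Qed.

(** The inner product counts solutions with one entry in each of the pieces [i] and
    [i'] and four entries in the transversal window, up to the tolerance of the
    kernel; by [transversality] the two entries are within one piece length, so
    that non-neighbouring pieces see none. *)
Lemma far_orthogonal (q m lJ m' l' D : nat) (i i' : 'I_q) :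
  admissible m (q * lJ) -> admissible m' l' -> (0 < D)%N ->
  (m' + D <= m)%N || (m + q * lJ + D <= m')%N ->
  (2 * H + 2 * (k * (2 * j.+1 * X ^ j.+1 * l' ^ 2)) <= lJ * (k * (2 * D * Y ^ j.+1)))%N ->
  far i i' ->
  \sum_(t < M) (window_sum (m + i * lJ) lJ t * window_sum m' l' t ^+ 2 * dirichlet t)
     * conjc (window_sum (m + i' * lJ) lJ t * window_sum m' l' t ^+ 2 * dirichlet t) = 0.
Proof.
move=> am am' D0 sep hl ii'; have /andP[hQ hM] := nc.
pose T := ('I_lJ * ('I_l' * 'I_l') * 'I_H)%type.
pose x (i : 'I_q) (p : T) : nat :=
  (f (m + i * lJ + p.1.1) + (f (m' + p.1.2.1) + f (m' + p.1.2.2)) + p.2)%N.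
have E (u : 'I_q) t : window_sum (m + u * lJ) lJ t * window_sum m' l' t ^+ 2 * dirichlet t = charsum R (x u) t.
  by rewrite expr2 /window_sum /dirichlet !charsumM.
under eq_bigr do rewrite !E.
have /andP[Ym mX] := am; have /andP[Ym' mX'] := am'.
have ltX (u : 'I_q) (a : 'I_lJ) : (m + u * lJ + a <= X)%N.
  by have /andP[_] := admissible_sub u am; have := ltn_ord a; lia.
have ltX' (a : 'I_l') : (m' + a <= X)%N by have := ltn_ord a; lia.
have bd (u : 'I_q) p : (x u p < M)%N.
  have F v : (v <= X)%N -> (f v <= f X)%N by exact: freq_mono.
  have := F _ (ltX u p.1.1); have := F _ (ltX' p.1.2.1); have := F _ (ltX' p.1.2.2).
  by have := ltn_ord p.2; rewrite /x; lia.
rewrite (parseval R M0 (bd i) (bd i')).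
suff -> : #|[pred p : T * T | x i p.1 == x i' p.2]| = 0%N by rewrite muln0.
apply: eq_card0 => -[p p']; rewrite !inE; apply: contraTF ii' => /eqP ep.
have {ep} : (x i p = x i' p') by [].
case: p => [[a [n1 n2]] h]; case: p' => [[a' [n3 n4]] h']; rewrite /x /=.
set A := (m + i * lJ + a)%N; set A' := (m + i' * lJ + a')%N.
set N1 := (m' + n1)%N; set N2 := (m' + n2)%N; set N3 := (m' + n3)%N; set N4 := (m' + n4)%N.
rewrite /freq => ep.
have pw u : (u <= X)%N -> (u ^ k <= X ^ k)%N by move=> uX; rewrite leq_exp2r.
have pA := pw _ (ltX i a); have pA' := pw _ (ltX i' a').
have p1 := pw _ (ltX' n1); have p2 := pw _ (ltX' n2).
have p3 := pw _ (ltX' n3); have p4 := pw _ (ltX' n4).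
have hH := ltn_ord h; have hH' := ltn_ord h'.
have [E2 Ek] : (A ^ 2 + N1 ^ 2 + N2 ^ 2 = A' ^ 2 + N3 ^ 2 + N4 ^ 2)%N /\
   (A ^ k + N1 ^ k + N2 ^ k + h = A' ^ k + N3 ^ k + N4 ^ k + h')%N.
  apply: (@freq_separates Q); [| |exact: freq_sum3 ep].
    exact: sum3_lt pA p1 p2 hH hQ.
  exact: sum3_lt pA' p3 p4 hH' hQ.
clear ep pA pA' p1 p2 p3 p4.
suff cl : (A <= A' + lJ)%N && (A' <= A + lJ)%N.
  move: cl => /andP[c1 c2]; rewrite /far negb_or -!leqNgt.
  apply/andP; split; first exact: (near_of_close (ltn_ord a') (ltn_ord a) c2).
  exact: (near_of_close (ltn_ord a) (ltn_ord a') c1).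
have YA : (Y <= A)%N by rewrite (leq_trans Ym)// /A -addnA leq_addr.
have YA' : (Y <= A')%N by rewrite (leq_trans Ym)// /A' -addnA leq_addr.
have sepA : (m' + D <= A)%N /\ (m' + D <= A')%N \/ (A + D <= m')%N /\ (A' + D <= m')%N.
  rewrite /A /A'; case/orP: sep => sp; [left|right].
    by split; apply: leq_trans sp _; rewrite -addnA leq_addr.
  by split; apply: leq_trans sp; rewrite leq_add2r -addnA leq_add2l ltnW// ord_block_lt.
have key (B B' : nat) (N1' N2' N3' N4' : nat) (g g' : 'I_H) :
   (Y <= B')%N -> (B' <= B)%N -> (m' + D <= B')%N \/ (B + D <= m')%N ->
   (forall n, n \in [:: N1'; N2'; N3'; N4'] -> (m' <= n <= m' + l')%N /\ (n <= X)%N) ->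
   (B ^ 2 + N1' ^ 2 + N2' ^ 2 = B' ^ 2 + N3' ^ 2 + N4' ^ 2)%N ->
   (B ^ k + N1' ^ k + N2' ^ k + g = B' ^ k + N3' ^ k + N4' ^ k + g')%N ->
   (B <= B' + lJ)%N.
  move=> YB BB sp hn e2 ek.
  have := @transversality R j Y%:R X%:R D%:R l'%:R H%:R m'%:R B%:R B'%:R
    N1'%:R N2'%:R N3'%:R N4'%:R.
  rewrite !ler_nat !ler0n => /(_ isT isT Ym' YB BB).
  have sp' : (m'%:R + D%:R <= B'%:R :> R) \/ (B%:R <= m'%:R - D%:R :> R).
    by case: sp => sp; [left|right]; rewrite ?lerBrDr -natrD ler_nat.
  move=> /(_ sp').
  have hn' (n : R) : n \in [:: N1'%:R; N2'%:R; N3'%:R; N4'%:R] ->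
      (m'%:R <= n <= m'%:R + l'%:R) /\ n <= X%:R.
    have -> : [:: N1'%:R; N2'%:R; N3'%:R; N4'%:R : R] = map (fun n => n%:R) [:: N1'; N2'; N3'; N4'] by [].
    by move=> /mapP[n0 /hn [h1 h2] ->]; rewrite -natrD !ler_nat.
  move=> /(_ hn').
  have e2' : B%:R ^+ 2 + N1'%:R ^+ 2 + N2'%:R ^+ 2 = B'%:R ^+ 2 + N3'%:R ^+ 2 + N4'%:R ^+ 2 :> R.
    by rewrite -!natrX -!natrD e2.
  move=> /(_ e2').
  have ek' : `|(B%:R ^+ k + N1'%:R ^+ k + N2'%:R ^+ k)
      - (B'%:R ^+ k + N3'%:R ^+ k + N4'%:R ^+ k)| <= H%:R :> R.
    rewrite -!natrX -!natrD ler_distl lerBlDr -!natrD !ler_nat.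
    exact: dist_lt ek (ltn_ord g) (ltn_ord g').
  move=> /(_ ek'); rewrite -natrB// -!natrX -!natrM -!natrD ler_nat => le1.
  have {}le1 := leq_trans le1 hl.
  rewrite -leq_subLR; move: le1.
  by rewrite leq_pmul2r// !muln_gt0 expn_gt0 D0 Y0.
have mem4 u1 u2 u3 u4 : (forall u, u \in [:: u1; u2; u3; u4] -> u \in [:: N1; N2; N3; N4]) ->
  forall n, n \in [:: u1; u2; u3; u4] -> (m' <= n <= m' + l')%N /\ (n <= X)%N.
  move=> sub n /sub; rewrite !inE => /or4P[] /eqP->;
    by rewrite /N1 /N2 /N3 /N4 leq_addr leq_add2l ltnW ?ltn_ord ?ltX'.
have [AA|/ltnW AA] := leqP A A'.
  rewrite (leq_trans AA) ?leq_addr//=.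
  apply: (key _ _ N3 N4 N1 N2 h' h) => //.
    by case: sepA => -[? ?]; [left|right].
  by apply: mem4 => u; rewrite !inE; do ![case/orP|move->; rewrite ?orbT].
rewrite (leq_trans AA) ?leq_addr//= andbT.
apply: (key _ _ N1 N2 N3 N4 h h') => //.
  by case: sepA => -[? ?]; [left|right].
by apply: mem4.
Qed.

Lemma mean_refine (q m lJ m' l' D : nat) :
  admissible m (q * lJ) -> admissible m' l' -> (0 < D)%N ->
  (m' + D <= m)%N || (m + q * lJ + D <= m')%N ->
  (2 * H + 2 * (k * (2 * j.+1 * X ^ j.+1 * l' ^ 2)) <= lJ * (k * (2 * D * Y ^ j.+1)))%N ->
  mean (fun t => window_norm m (q * lJ) t ^+ 2 * window_norm m' l' t ^+ 4)
    <= 3 * \sum_(i < q) mean (fun t => window_norm (m + i * lJ) lJ t ^+ 2 * window_norm m' l' t ^+ 4).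
Proof.
move=> am am' D0 sep hl.
have := @almost_orthogonal R M q
  (fun i t => window_sum (m + i * lJ) lJ t * window_sum m' l' t ^+ 2 * dirichlet t).
move=> /(_ (fun i i' => far_orthogonal am am' D0 sep hl (i := i) (i' := i'))).
have E (z1 z2 z3 : R[i]) : normc (z1 * z2 ^+ 2 * z3) ^+ 2
    = normc z1 ^+ 2 * normc z2 ^+ 4 * normc z3 ^+ 2.
  by rewrite 2!normcM normcX; ring.
congr (_ <= _).
  by rewrite /mean; apply: eq_bigr => t _; rewrite -!mulr_suml -window_sum_split E.
by congr (3 * _); apply: eq_bigr => i _; apply: eq_bigr => t _; rewrite E.
Qed.

Variables (r s : nat) (B : R).
Hypothesis r0 : (0 < r)%N.
Hypothesis s128 : (128 <= s)%N.
Hypothesis res : resolves k H X Y s r.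
Hypothesis B0 : 0 <= B.

(* [r] is the length of the short windows; in the application it is of order the
   square root of [Y]. *)
Let len q := (r * s ^ q)%N.
Let s0 : (0 < s)%N. Proof. exact: leq_trans s128. Qed.
Let sR0 : 0 < s%:R :> R. Proof. by rewrite ltr0n. Qed.

(** [B] stands for a bound on the mean of the sixth power over the short windows,
    so that the normalised bound for [q = 0] is [1]; the factor
    [s ^ (3 q)] is what square-root cancellation would give. *)
Definition sixth_bound q (c : R) := forall m, admissible m (len q) ->
  mean (fun t => window_norm m (len q) t ^+ 6) <= c * s%:R ^+ (3 * q) * B.

Definition separated m l m' l' (D : nat) :=
  (m' + l' + D <= m)%N || (m + l + D <= m')%N.

Definition bilinear_bound p a b (c : R) := forall m m', admissible m (len (p - a)) ->
  admissible m' (len (p - b)) -> separated m (len (p - a)) m' (len (p - b)) (len p.-1) ->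
  mean (fun t => window_norm m (len (p - a)) t ^+ 2 * window_norm m' (len (p - b)) t ^+ 4)
    <= c * s%:R ^+ ((p - a) + 2 * (p - b)) * B.

Lemma sixth_bound_le q c c' : c <= c' -> sixth_bound q c -> sixth_bound q c'.
Proof.
move=> cc h m am; apply: le_trans (h m am) _.
by rewrite ler_wpM2r// ler_wpM2r// exprn_ge0.
Qed.

Lemma bilinear_bound_le p a b c c' : c <= c' -> bilinear_bound p a b c -> bilinear_bound p a b c'.
Proof.
move=> cc h m m' am am' sep; apply: le_trans (h m m' am am' sep) _.
by rewrite ler_wpM2r// ler_wpM2r// exprn_ge0.
Qed.

(** [u v ^ 2 <= u ^ 3 + v ^ 3] after normalising both sums. *)
Lemma bilinear_bound_young p a b c : sixth_bound (p - a) c -> sixth_bound (p - b) c ->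
  bilinear_bound p a b (2 * c).
Proof.
move=> ha hb m m' am am' _.
have S_gt0 := sR0; set S := s%:R : R in S_gt0 *; set u := (p - a)%N; set v := (p - b)%N.
apply: (@le_trans _ _ (mean (fun t => S ^+ (u + 2 * v) *
   ((S ^+ (3 * u))^-1 * window_norm m (len u) t ^+ 6
    + (S ^+ (3 * v))^-1 * window_norm m' (len v) t ^+ 6)))).
  apply: le_mean => t.
  have : 0 <= window_norm m (len u) t ^+ 2 by rewrite exprn_ge0 ?window_norm_ge0.
  have : 0 <= window_norm m' (len v) t ^+ 2 by rewrite exprn_ge0 ?window_norm_ge0.
  move: (window_norm m _ t) (window_norm m' _ t) => x y y0 x0.
  have SX n : 0 < S ^+ n by exact: exprn_gt0.
  set x' := x ^+ 2 / S ^+ u; set y' := y ^+ 2 / S ^+ v.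
  have x'0 : 0 <= x' by rewrite divr_ge0// ltW.
  have y'0 : 0 <= y' by rewrite divr_ge0// ltW.
  have -> : x ^+ 2 * y ^+ 4 = S ^+ (u + 2 * v) * (x' * y' ^+ 2).
    rewrite /x' /y' exprD mulnC exprM; field.
    by rewrite !gt_eqF.
  have -> : (S ^+ (3 * u))^-1 * x ^+ 6 + (S ^+ (3 * v))^-1 * y ^+ 6 = x' ^+ 3 + y' ^+ 3.
    rewrite /x' /y' [(3 * u)%N]mulnC [(3 * v)%N]mulnC !exprM; field.
    by rewrite !gt_eqF.
  rewrite ler_wpM2l//; first by rewrite ltW.
  have [xy|/ltW yx] := leP x' y'.
    apply: (@le_trans _ _ (y' ^+ 3)); first by rewrite [leRHS]exprS ler_wpM2r ?exprn_ge0.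
    by rewrite lerDr exprn_ge0.
  apply: (@le_trans _ _ (x' ^+ 3)); last by rewrite lerDl exprn_ge0.
  by rewrite [leRHS]exprS ler_wpM2l// lerXn2r// nnegrE.
rewrite meanZ meanD !meanZ.
have -> : 2 * c * S ^+ (u + 2 * v) * B = S ^+ (u + 2 * v) * (c * B + c * B) by ring.
rewrite ler_wpM2l ?exprn_ge0 ?(ltW S_gt0)//.
by apply: lerD; rewrite ler_pdivrMl ?exprn_gt0//; [have := ha _ am|have := hb _ am'];
  rewrite -/S -/u -/v; congr (_ <= _); ring.
Qed.

(** With separation [len p.-1], the resolution attached to a window of length
    [len (p - b)] is [len (p - (2 b - 2))], because
    [len (p - (2 b - 2)) * len p.-1 = s * len (p - b) ^ 2]. *)
Lemma bilinear_bound_refine p a b c : (0 < a)%N -> (a <= b.*2.-2)%N -> (b.*2.-2 <= p)%N ->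
  bilinear_bound p b.*2.-2 b c -> bilinear_bound p a b (3 * c).
Proof.
move=> a0 ab bp h m m' am am' sep.
set b' := b.*2.-2 in ab bp h *.
have b1 : (1 < b)%N by move: a0 ab; rewrite /b'; lia.
have p0 : (0 < p)%N by lia.
pose q := (s ^ (b' - a))%N.
have lE : len (p - a) = (q * len (p - b'))%N.
  by rewrite /len /q mulnCA -expnD; congr (_ * s ^ _)%N; lia.
rewrite lE in am sep *.
apply: le_trans (mean_refine am am' (D := len p.-1) _ _ _) _.
- by rewrite muln_gt0 r0 expn_gt0 s0.
- by case/orP: sep => sep; apply/orP; [left|right]; lia.
- have E : (len (p - b') * len p.-1 = s * len (p - b) ^ 2)%N.
    rewrite /len mulnACA -expnD (_ : p - b' + p.-1 = ((p - b) * 2).+1)%N; last first.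
      by rewrite /b'; lia.
    by rewrite expnS expnM; ring.
  apply: (@res (len (p - b))); last by rewrite E.
  by rewrite /len leq_pmulr// expn_gt0 s0.
rewrite -!(mulrA 3) ler_wpM2l//.
apply: (@le_trans _ _ (\sum_(i < q) c * s%:R ^+ (p - b' + 2 * (p - b)) * B)).
  apply: ler_sum => i _; apply: h => //; first exact: admissible_sub am.
  rewrite /separated; have : (i.+1 * len (p - b') <= q * len (p - b'))%N.
    by rewrite leq_mul2r ltn_ord orbT.
  by rewrite mulSn; case/orP: sep => sep ?; apply/orP; [left|right]; lia.
rewrite sumr_const card_ord -[leLHS]mulr_natl /q natrX.
have -> : (p - a + 2 * (p - b) = (b' - a) + (p - b' + 2 * (p - b)))%N by lia.
by rewrite [in leRHS]exprD le_eqVlt; apply/orP; left; apply/eqP; ring.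
Qed.

(** Cauchy-Schwarz applied to [u ^ 2 v ^ 4 = (v u ^ 2) (v ^ 3)]; the normalising
    powers of [s] match exactly. *)
Lemma bilinear_bound_swap p a b c c1 c2 : 0 <= c -> c1 * c2 <= c ^+ 2 ->
  bilinear_bound p b a c1 -> sixth_bound (p - b) c2 -> bilinear_bound p a b c.
Proof.
move=> c0 hc h1 h2 m m' am am' sep.
have sep' : separated m' (len (p - b)) m (len (p - a)) (len p.-1).
  by rewrite /separated orbC.
have {}h1 := h1 _ _ am' am sep'; have {}h2 := h2 _ am'.
set u := (p - a)%N in h1 *; set v := (p - b)%N in h1 h2 *.
have S0 n : 0 <= s%:R ^+ n :> R by rewrite exprn_ge0 ?ler0n.
have I0 : 0 <= mean (fun t => window_norm m (len u) t ^+ 2 * window_norm m' (len v) t ^+ 4).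
  by apply: mean_ge0 => t; rewrite mulr_ge0 ?exprn_ge0 ?window_norm_ge0.
rewrite -(@ler_pXn2r _ 2)// ?nnegrE//; last by rewrite !mulr_ge0.
have -> : mean (fun t => window_norm m (len u) t ^+ 2 * window_norm m' (len v) t ^+ 4)
  = mean (fun t => (window_norm m' (len v) t * window_norm m (len u) t ^+ 2) * window_norm m' (len v) t ^+ 3).
  by rewrite /mean; apply: eq_bigr => t _; ring.
apply: le_trans; first exact: mean_CS.
apply: (@le_trans _ _ ((c1 * s%:R ^+ (v + 2 * u) * B) * (c2 * s%:R ^+ (3 * v) * B))).
  apply: ler_pM.
  - by apply: mean_ge0 => t; rewrite exprn_ge0// mulr_ge0 ?exprn_ge0 ?window_norm_ge0.
  - by apply: mean_ge0 => t; rewrite exprn_ge0// exprn_ge0 ?window_norm_ge0.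
  - apply: le_trans h1; rewrite le_eqVlt; apply/orP; left; apply/eqP.
    by rewrite /mean; apply: eq_bigr => t _; ring.
  apply: le_trans h2; rewrite le_eqVlt; apply/orP; left; apply/eqP.
  by rewrite /mean; apply: eq_bigr => t _; ring.
have -> : (c * s%:R ^+ (u + 2 * v) * B) ^+ 2 = c ^+ 2 * (s%:R ^+ (2 * u + 4 * v) * B ^+ 2).
  rewrite !exprMn -exprM -mulrA; congr (_ * (_ ^+ _ * _)); ring.
have -> : c1 * s%:R ^+ (v + 2 * u) * B * (c2 * s%:R ^+ (3 * v) * B)
   = c1 * c2 * (s%:R ^+ (2 * u + 4 * v) * B ^+ 2).
  have -> : (2 * u + 4 * v = (v + 2 * u) + 3 * v)%N by ring.
  by rewrite (exprD _ (v + 2 * u)); ring.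
by rewrite ler_wpM2r// mulr_ge0// exprn_ge0.
Qed.

Lemma window_norm_split_le n m q l t :
  window_norm m (q * l) t ^+ n.+1 <= q%:R ^+ n * \sum_(i < q) window_norm (m + i * l) l t ^+ n.+1.
Proof.
apply: le_trans (power_mean_sum _ _); last by move=> i; exact: window_norm_ge0.
rewrite lerXn2r// ?nnegrE ?window_norm_ge0//; first by apply: sumr_ge0 => i _; exact: window_norm_ge0.
rewrite /window_norm window_sum_split; exact: normc_sum.
Qed.

Lemma bilinear_bound_shrink p a b b' c : (b <= b' <= p)%N ->
  bilinear_bound p a b' c -> bilinear_bound p a b (s%:R ^+ (2 * (b' - b)) * c).
Proof.
move=> /andP[bb' b'p] h m m' am am' sep.
pose q := (s ^ (b' - b))%N.
have lE : len (p - b) = (q * len (p - b'))%N.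
  by rewrite /len /q mulnCA -expnD; congr (_ * s ^ _)%N; lia.
rewrite lE in am' sep *.
apply: (@le_trans _ _ (mean (fun t => q%:R ^+ 3 * \sum_(i < q)
    (window_norm m (len (p - a)) t ^+ 2 * window_norm (m' + i * len (p - b')) (len (p - b')) t ^+ 4)))).
  apply: le_mean => t; rewrite -mulr_sumr [leRHS]mulrCA ler_wpM2l ?exprn_ge0 ?window_norm_ge0//.
  exact: window_norm_split_le.
rewrite meanZ mean_sum.
apply: (@le_trans _ _ (q%:R ^+ 3 * \sum_(i < q) c * s%:R ^+ (p - a + 2 * (p - b')) * B)).
  rewrite ler_wpM2l ?exprn_ge0 ?ler0n//; apply: ler_sum => i _.
  apply: h => //; first exact: admissible_sub am'.
  rewrite /separated; have : (i.+1 * len (p - b') <= q * len (p - b'))%N.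
    by rewrite leq_mul2r ltn_ord orbT.
  by rewrite mulSn; case/orP: sep => sep ?; apply/orP; [left|right]; lia.
rewrite sumr_const card_ord -[X in _ * X]mulr_natl /q natrX.
have -> : (p - a + 2 * (p - b) = 2 * (b' - b) + (p - a + 2 * (p - b')))%N by lia.
rewrite le_eqVlt; apply/orP; left; apply/eqP.
by rewrite [in RHS](exprD _ (2 * (b' - b))) [(2 * (b' - b))%N]mulnC exprM; ring.
Qed.

Lemma sixth_bound_succ q c : sixth_bound q c -> sixth_bound q.+1 (s%:R ^+ 3 * c).
Proof.
move=> h m; have lE : len q.+1 = (s * len q)%N by rewrite /len expnS mulnCA.
rewrite lE => am.
apply: (@le_trans _ _ (mean (fun t => s%:R ^+ 5 * \sum_(i < s)
    window_norm (m + i * len q) (len q) t ^+ 6))).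
  apply: le_mean => t; exact: window_norm_split_le.
rewrite meanZ mean_sum.
apply: (@le_trans _ _ (s%:R ^+ 5 * \sum_(i < s) c * s%:R ^+ (3 * q) * B)).
  rewrite ler_wpM2l ?exprn_ge0 ?ler0n//; apply: ler_sum => i _.
  by apply: h; exact: admissible_sub am.
rewrite sumr_const card_ord -[X in _ * X]mulr_natl mulnS exprD.
rewrite le_eqVlt; apply/orP; left; apply/eqP; ring.
Qed.

(** The narrow part involves [s] windows one scale down, which the normalisation
    [s ^ 3] turns into a factor [4 ^ 6 / s ^ 2], at most a quarter as [s >= 128]. *)
Lemma sixth_bound_broad_narrow p c1 c2 : 0 <= c1 -> 0 <= c2 ->
  sixth_bound p c1 -> bilinear_bound p.+1 1 1 c2 ->
  sixth_bound p.+1 (c1 / 4 + s%:R ^+ 8 * c2).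
Proof.
move=> c10 c20 h1 h2 m; have lE : len p.+1 = (s * len p)%N by rewrite /len expnS mulnCA.
rewrite lE => am.
pose u (i : 'I_s) t := window_norm (m + i * len p) (len p) t.
have u0 i t : 0 <= u i t by exact: window_norm_ge0.
apply: (@le_trans _ _ (mean (fun t => 4 ^+ 6 * (\sum_i u i t ^+ 6)
   + s%:R ^+ 9 * \sum_(i < s) \sum_(i' < s | far i i')
       (2^-1 * (u i t ^+ 2 * u i' t ^+ 4) + 2^-1 * (u i' t ^+ 2 * u i t ^+ 4))))).
  apply: le_mean => t; rewrite /window_norm window_sum_split; apply: le_trans (broad_narrow _ s0) _.
  rewrite lerD2l ler_wpM2l ?exprn_ge0 ?ler0n//.
  apply: ler_sum => i _; apply: ler_sum => i' _.
  rewrite -!/(window_norm _ _ _) -!/(u _ _).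
  have : 0 <= (u i t * u i' t * (u i t - u i' t)) ^+ 2 by exact: sqr_ge0.
  by lra.
rewrite meanD !meanZ !mean_sum.
apply: (@le_trans _ _ (4 ^+ 6 * (\sum_(i < s) c1 * s%:R ^+ (3 * p) * B)
   + s%:R ^+ 9 * \sum_(i < s) \sum_(i' < s) (c2 * s%:R ^+ (3 * p) * B))).
  apply: lerD; (rewrite ler_wpM2l ?exprn_ge0 ?ler0n//; apply: ler_sum => i _).
    by apply: h1; exact: admissible_sub am.
  rewrite mean_sum [leLHS]big_mkcond/=; apply: ler_sum => i' _.
  case: ifP => [fi|_]; last by rewrite !mulr_ge0// exprn_ge0.
  rewrite meanD !meanZ.
  have bil (i1 i2 : 'I_s) : far i1 i2 ->
      mean (fun t => u i1 t ^+ 2 * u i2 t ^+ 4) <= c2 * s%:R ^+ (3 * p) * B.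
    move=> f12; have -> : (3 * p = (p.+1 - 1) + 2 * (p.+1 - 1))%N by lia.
    have := h2 (m + i1 * len p)%N (m + i2 * len p)%N.
    rewrite subn1/=; apply; [exact: admissible_sub am|exact: admissible_sub am|].
    rewrite /separated; have mono (x y : nat) : (x.+1 < y)%N -> (x * len p + len p + len p <= y * len p)%N.
      move=> xy; have : (x.+2 * len p <= y * len p)%N by rewrite leq_mul2r xy orbT.
      by rewrite !mulSn; lia.
    by case/orP: f12 => /mono ?; apply/orP; [right|left]; lia.
  have := bil _ _ fi; have := bil i' i; rewrite /far orbC => /(_ fi).
  by set a1 := mean _; set a2 := mean _; set a3 := _ * B; lra.
have sumE (x : R) : \sum_(i < s) x = s%:R * x by rewrite sumr_const card_ord mulr_natl.
rewrite !sumE mulnS addnC exprD.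
have S128 : 128 <= s%:R :> R by rewrite ler_nat.
have T0 : 0 <= s%:R * (c1 * (s%:R ^+ (3 * p) * B)).
  by rewrite !mulr_ge0// exprn_ge0.
move: T0 S128; move: (s%:R ^+ (3 * p)) => T; move: (s%:R : R) => S T0 S128.
rewrite -subr_ge0; have -> : (c1 / 4 + S ^+ 8 * c2) * (T * S ^+ 3) * B
    - (4 ^+ 6 * (S * (c1 * T * B)) + S ^+ 9 * (S * (S * (c2 * T * B))))
  = (S * (c1 * (T * B))) * ((S ^+ 2 - 128 ^+ 2) / 4) by field.
apply: mulr_ge0 => //; apply: divr_ge0 => //.
by rewrite subr_ge0 lerXn2r// nnegrE//; lra.
Qed.

Lemma decoupling (theta sigma : R) n :
  sixth_bound 0 1 -> 1 <= theta -> theta <= sigma ->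
  theta ^+ (2 ^ n.+2) = s%:R -> s%:R ^+ 5 <= sigma ^+ n.+2 ->
  forall p, sixth_bound p ((36 * s%:R ^+ 13) ^+ (3 * 2 ^ n.+2) * sigma ^+ p).
Proof.
move=> base; apply: (bootstrap (bil := bilinear_bound)) => //.
- by rewrite ler1n.
- exact: sixth_bound_le.
- exact: bilinear_bound_le.
- exact: sixth_bound_succ.
- exact: sixth_bound_broad_narrow.
- exact: bilinear_bound_young.
- exact: bilinear_bound_refine.
- exact: bilinear_bound_swap.
- exact: bilinear_bound_shrink.
Qed.

End Decoupling.

(** * Windows of length the square root: the divisor bound *)

Section DivisorBound.
Local Open Scope nat_scope.

(** A divisor of [m * p ^ e] is a divisor of [m] times a power of [p]. *)
Lemma divisors_coprime_pfactor p m e : prime p -> 0 < m -> coprime p m ->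
  size (divisors (m * p ^ e)) <= size (divisors m) * e.+1.
Proof.
move=> pp m0 pm.
have mp0 : 0 < m * p ^ e by rewrite muln_gt0 m0 expn_gt0 prime_gt0.
pose L := [seq x * p ^ i | x <- divisors m, i <- iota 0 e.+1].
have -> : size (divisors m) * e.+1 = size L by rewrite size_allpairs size_iota.
apply: uniq_leq_size (divisors_uniq _) _ => d; rewrite -dvdn_divisors// => dmp.
have d0 : 0 < d by exact: dvdn_gt0 dmp.
have [a pa dE] := pfactor_coprime pp d0.
have am : a \in divisors m.
  rewrite -dvdn_divisors//.
  have : a %| m * p ^ e by rewrite (dvdn_trans _ dmp)// dE dvdn_mulr.
  by rewrite Gauss_dvdl// coprime_sym coprimeXl.
have le : logn p d \in iota 0 e.+1.
  rewrite mem_iota add0n ltnS.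
  have := dvdn_leq_log p mp0 dmp; rewrite lognM ?expn_gt0 ?(prime_gt0 pp)//.
  by rewrite (logn_coprime pm) pfactorK.
by rewrite dE; apply: allpairs_f.
Qed.

Lemma succ_exp_le j e : 0 < j -> e.+1 ^ j <= j ^ j * 2 ^ e.
Proof.
move=> j0; rewrite {1}(divn_eq e j).
have h : (e %/ j * j + e %% j).+1 <= j * (e %/ j).+1.
  by rewrite mulnS mulnC addnC -addSn leq_add2r ltn_mod.
apply: (@leq_trans ((j * 2 ^ (e %/ j)) ^ j)).
  by rewrite leq_exp2r// (leq_trans h)// leq_mul2l ltn_expl ?orbT.
by rewrite expnMn -expnM leq_mul2l leq_exp2l// leq_divM orbT.
Qed.

(** A prime [p >= 2 ^ j] of multiplicity [e] costs nothing, as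
    [(e + 1) ^ j <= 2 ^ (e j) <= p ^ e]; each of the finitely many smaller primes
    costs at most the factor [j ^ j]. *)
Lemma divisor_bound j : 0 < j ->
  exists K, forall n, 0 < n -> size (divisors n) ^ j <= K * n.
Proof.
move=> j0; exists ((j ^ j) ^ (2 ^ j)) => n n0.
pose small n := #|[pred q : 'I_(2 ^ j) | prime q && (q %| n)]|.
suff H : size (divisors n) ^ j <= (j ^ j) ^ small n * n.
  apply: leq_trans H _; rewrite leq_mul2r leq_pexp2l ?orbT//.
    by rewrite expn_gt0 j0.
  by rewrite (leq_trans (max_card _))// card_ord.
elim/ltn_ind: n n0 => n IH n0; have [n1|n1] := leqP n 1.
  by rewrite (_ : n = 1) ?divisors1 ?exp1n ?muln1 ?expn_gt0 ?j0//; lia.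
pose p := pdiv n; have pp : prime p by exact: pdiv_prime.
have [m pm nE] := pfactor_coprime pp n0; set e := logn p n in nE.
have e0 : 0 < e by rewrite logn_gt0 mem_primes pp n0 pdiv_dvd.
have m0 : 0 < m by move: n0; rewrite nE muln_gt0 => /andP[].
have pe1 : 1 < p ^ e by rewrite -(exp1n e) ltn_exp2r// prime_gt1.
have mn : m < n by rewrite nE ltn_Pmulr.
have {}IH := IH m mn m0.
have sub : {subset [pred q : 'I_(2 ^ j) | prime q && (q %| m)] <=
                   [pred q : 'I_(2 ^ j) | prime q && (q %| n)]}.
  by move=> q; rewrite !inE => /andP[-> qm]; rewrite nE dvdn_mulr.
have le1 : size (divisors n) ^ j <= size (divisors m) ^ j * e.+1 ^ j.
  by rewrite -expnMn leq_exp2r// nE divisors_coprime_pfactor.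
apply: leq_trans le1 _.
have [pl|ps] := leqP (2 ^ j) p.
  rewrite {2}nE mulnA leq_mul//.
    apply: leq_trans IH _; rewrite leq_mul2r leq_pexp2l ?orbT ?expn_gt0 ?j0//.
    by apply: subset_leq_card; apply/fintype.subsetP.
  apply: (@leq_trans ((2 ^ e) ^ j)); first by rewrite leq_exp2r// ltn_expl.
  by rewrite -expnM mulnC expnM leq_exp2r.
have lt_small : small m < small n.
  apply: proper_card; apply/properP; split; first exact/fintype.subsetP.
  exists (Ordinal ps); first by rewrite inE /= pp pdiv_dvd.
  by rewrite inE /= pp/= -prime_coprime.
apply: (@leq_trans (((j ^ j) ^ small m * m) * (j ^ j * p ^ e))).
  rewrite leq_mul//; apply: leq_trans (succ_exp_le e j0) _.
  by rewrite leq_mul2l leq_exp2r ?prime_gt1 ?orbT.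
rewrite {2}nE mulnACA leq_mul2r -expnSr leq_pexp2l ?orbT//.
by rewrite expn_gt0 j0.
Qed.

End DivisorBound.

Lemma card_inj_le_in (T U : finType) (A : pred T) (B : pred U) (g : T -> U) :
  {in A &, injective g} -> {in A, forall x, g x \in B} -> (#|A| <= #|B|)%N.
Proof.
move=> gi gB; rewrite -(card_in_imset gi); apply: subset_leq_card.
by apply/fintype.subsetP => _ /imsetP[x xA ->]; exact: gB.
Qed.

Lemma card_inj_le (T U : finType) (A : pred T) (g : T -> U) :
  {in A &, injective g} -> (#|A| <= #|U|)%N.
Proof. by move=> gi; rewrite -(card_in_imset gi) max_card. Qed.

Section BaseCount.
Local Open Scope ring_scope.
Variables (r c D : nat) (m : int).
Hypothesis hD : forall n, (0 < n <= 2 * r ^ 2)%N -> (size (divisors n) <= D)%N.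

Let T3 := ('I_r * 'I_r * 'I_r)%type.

Let z (i : 'I_r) : int := (i : nat)%:Z.

Let z_inj : injective z.
Proof. by move=> i i' [] /val_inj. Qed.

Definition drift (t : T3 * T3) : int :=
  z t.1.1.1 + z t.1.1.2 + z t.1.2 - (z t.2.1.1 + z t.2.1.2 + z t.2.2).

Definition drift2 (t : T3 * T3) : int :=
  z t.1.1.1 ^+ 2 + z t.1.1.2 ^+ 2 + z t.1.2 ^+ 2
   - (z t.2.1.1 ^+ 2 + z t.2.1.2 ^+ 2 + z t.2.2 ^+ 2).

(** The equations satisfied by the offsets [h_i] when [n_i = m + h_i] solves the
    quadratic equation, [drift] being the signed sum of the [h_i], which [c] bounds. *)
Definition base_set (t : T3 * T3) : bool :=
  (`|drift t| <= c)%N && (drift2 t == - (2 * m * drift t)).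

Let prod2 (t : T3 * T3) : int :=
  (z t.1.1.1 - z t.2.1.1) * (z t.1.1.2 - z t.2.1.1).

(* With [P = h1 + h2 - h4] and [Q = h1 ^ 2 + h2 ^ 2 - h4 ^ 2], both determined by
   the drift and by [h3], [h5], [h6], one has [2 (h1 - h4) (h2 - h4) = P ^ 2 - Q]. *)
Let twice_prod (s h3 h5 h6 : int) : int :=
  (s + h5 + h6 - h3) ^+ 2 - (h5 ^+ 2 + h6 ^+ 2 - h3 ^+ 2 - 2 * m * s).

Let prod2E t : base_set t ->
  2 * prod2 t = twice_prod (drift t) (z t.1.2) (z t.2.1.2) (z t.2.2).
Proof.
case: t => [[[h1 h2] h3] [[h4 h5] h6]] /andP[_ /eqP]; rewrite /prod2 /twice_prod /drift2 /drift /=.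
move: (z h1) (z h2) (z h3) (z h4) (z h5) (z h6) => a1 a2 a3 a4 a5 a6 E.
have -> : 2 * m * (a1 + a2 + a3 - (a4 + a5 + a6)) =
  - (a1 ^+ 2 + a2 ^+ 2 + a3 ^+ 2 - (a4 ^+ 2 + a5 ^+ 2 + a6 ^+ 2)) by rewrite E; ring.
ring.
Qed.

Let encode_drift (t : T3 * T3) : 'I_(2 * c).+1 := inord (absz (drift t + c%:Z)).

Let encode_drift_inj t t' : base_set t -> base_set t' ->
  encode_drift t = encode_drift t' -> drift t = drift t'.
Proof.
move=> /andP[ht _] /andP[ht' _] /(congr1 val); rewrite /= !inordK; lia.
Qed.

(** Here [h4] equals [h1] or [h2], so that [h4], one bit and the drift recover
    [h1] and [h2] from the rest.  The condition on [h3, h5, h6] is affine in [h6]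
    with slope [2 (h5 - h3 + drift)], so two of these three coordinates suffice as well:
    either the slope vanishes and gives [h5], or it does not and gives [h6]. *)
Lemma card_base_degenerate :
  (#|[pred t | base_set t & prod2 t == 0]| <= (2 * c).+1 * (4 * r ^ 3))%N.
Proof.
pose g (t : T3 * T3) : 'I_(2 * c).+1 * ((bool * 'I_r * 'I_r) * (bool * 'I_r)) :=
  let: b := z t.2.1.2 - z t.1.2 + drift t == 0 in
  (encode_drift t, ((b, t.1.2, if b then t.2.2 else t.2.1.2),
     (t.1.1.1 == t.2.1.1, t.2.1.1))).
have gi : {in [pred t | base_set t & prod2 t == 0] &, injective g}.
  move=> t t'; rewrite !inE => /andP[bt /eqP pt] /andP[bt' /eqP pt'] [] /(encode_drift_inj bt bt').
  have := prod2E bt; have := prod2E bt'; rewrite pt pt' mulr0.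
  move: pt pt'; rewrite /prod2 /twice_prod.
  case: t bt => [[[h1 h2] h3] [[h4 h5] h6]] bt.
  case: t' bt' => [[[k1 k2] k3] [[k4 k5] k6]] bt' /=.
  set d' := drift _; set d := drift _ => pt pt' eq' eq dd eb e3 e56 e14 e4.
  subst k3 k4; rewrite -dd in eq' eb e56.
  have [e5 e6] : h5 = k5 /\ h6 = k6.
    have [b0|b0] := eqVneq (z h5 - z h3 + d) 0.
      have b0' : z k5 - z h3 + d == 0 by rewrite -eb b0 eqxx.
      move: e56; rewrite b0 eqxx b0' => ->; split=> //; apply: z_inj.
      by move: b0 b0' => + /eqP; clear; lia.
    have b0' : z k5 - z h3 + d == 0 = false by rewrite -eb; exact: negbTE.
    move: e56; rewrite (negbTE b0) b0' => e5; subst k5; split=> //; apply: z_inj.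
    apply: (mulfI (x := 2 * (z h5 - z h3 + d))); first by rewrite mulf_neq0.
    have K (a3 a5 a6 : int) : (d + a5 + a6 - a3) ^+ 2 - (a5 ^+ 2 + a6 ^+ 2 - a3 ^+ 2 - 2 * m * d)
      = 2 * (a5 - a3 + d) * a6 + ((d + a5 - a3) ^+ 2 - (a5 ^+ 2 - a3 ^+ 2 - 2 * m * d)) by ring.
    by rewrite !K in eq eq'; move: eq; rewrite eq' => /addIr.
  subst k5 k6.
  have dd' : z h1 + z h2 = z k1 + z k2.
    by move: dd; rewrite /d /d' /drift /=; clear; lia.
  have [h14|h14] := eqVneq h1 h4.
    move: e14; rewrite h14 eqxx => /esym/eqP e14; subst h1 k1.
    suff -> : h2 = k2 by [].
    by apply: z_inj; move: dd'; clear; lia.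
  have hk14 : k1 != h4 by rewrite -e14.
  have [e2 e2'] : z h2 = z h4 /\ z k2 = z h4.
    have nz i : i != h4 -> z i - z h4 != 0.
      by rewrite subr_eq0; apply: contraNneq => /z_inj ->.
    split; apply/eqP; rewrite -subr_eq0.
      by move/eqP: pt; rewrite mulf_eq0 (negbTE (nz _ h14)).
    by move/eqP: pt'; rewrite mulf_eq0 (negbTE (nz _ hk14)).
  have -> : h2 = k2 by apply: z_inj; rewrite e2 e2'.
  suff -> : h1 = k1 by [].
  by apply: z_inj; move: dd' e2 e2'; clear; lia.
apply: leq_trans (card_inj_le gi) _.
rewrite !card_prod !card_ord card_bool leq_mul2l; apply/orP; right; clear.
by rewrite leq_eqVlt; apply/orP; left; apply/eqP; ring.
Qed.

(** Given the drift and [h3, h5, h6], the difference [h1 - h4] divides a known nonzero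
    integer; its sign and its rank among the divisors determine it, hence the
    cofactor [h2 - h4], and finally [h4] itself from the drift. *)
Lemma card_base_generic :
  (#|[pred t | base_set t & prod2 t != 0]| <= (2 * c).+1 * (2 * D.+1 * r ^ 3))%N.
Proof.
pose u (t : T3 * T3) := z t.1.1.1 - z t.2.1.1.
pose E (t : T3 * T3) := twice_prod (drift t) (z t.1.2) (z t.2.1.2) (z t.2.2).
pose g (t : T3 * T3) : 'I_(2 * c).+1 * (T3 * (bool * 'I_D.+1)) :=
  (encode_drift t, ((t.1.2, t.2.1.2, t.2.2),
     (u t < 0, inord (index `|u t|%N (divisors `|E t|%N))))).
have u_div t : base_set t -> prod2 t != 0 ->
    (`|u t|%N \in divisors `|E t|%N) /\ (size (divisors `|E t|%N) <= D)%N.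
  move=> bt pt; have Et : E t = 2 * prod2 t by rewrite (prod2E bt).
  have En0 : (0 < `|E t|)%N by rewrite absz_gt0 Et mulf_neq0.
  split.
    rewrite -dvdn_divisors// Et /prod2 !abszM -/(u t) mulnCA dvdn_mulr//.
  apply: hD; rewrite En0/= Et /prod2 !abszM leq_mul2l/= -mulnn leq_mul//.
    by have := ltn_ord t.1.1.1; have := ltn_ord t.2.1.1; rewrite /z; clear; lia.
  by have := ltn_ord t.1.1.2; have := ltn_ord t.2.1.1; rewrite /z; clear; lia.
have gi : {in [pred t | base_set t & prod2 t != 0] &, injective g}.
  move=> t t'; rewrite !inE => /andP[bt pt] /andP[bt' pt'] [] /(encode_drift_inj bt bt').
  have [ut st] := u_div t bt pt; have [ut' st'] := u_div t' bt' pt'.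
  have Et : E t = 2 * prod2 t by rewrite (prod2E bt).
  have Et' : E t' = 2 * prod2 t' by rewrite (prod2E bt').
  move=> dd e3 e5 e6 es.
  have EE : E t = E t' by rewrite /E dd e3 e5 e6.
  move=> /(congr1 val); rewrite /= !inordK ?ltnS; last first.
  - by rewrite (leq_trans _ st)// index_size.
  - by rewrite (leq_trans _ st')// index_size.
  rewrite -EE in ut' *; move=> /(congr1 (nth 0%N (divisors `|E t|%N))).
  rewrite !nth_index// => eu.
  have {}eu : u t = u t' by move: eu es; rewrite -!/(u _); clear; lia.
  have uv : z t.1.1.2 - z t.2.1.1 = z t'.1.1.2 - z t'.2.1.1.
    have : prod2 t = prod2 t' by apply: (mulfI (x := 2)) => //; rewrite -Et -Et'.
    rewrite /prod2 -/(u t) -/(u t') eu; apply: mulfI.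
    by move: pt'; rewrite /prod2 mulf_eq0 negb_or => /andP[].
  move: e3 e5 e6 dd eu uv; rewrite /u /drift.
  case: t {bt pt ut st Et EE ut' es} => [[[h1 h2] h3] [[h4 h5] h6]].
  case: t' {bt' pt' st' Et'} => [[[k1 k2] k3] [[k4 k5] k6]] /= -> -> -> dd eu uv.
  have e4 : h4 = k4 by apply: z_inj; move: dd eu uv; clear; lia.
  have -> : h1 = k1 by apply: z_inj; move: eu; rewrite e4; clear; lia.
  have -> : h2 = k2 by apply: z_inj; move: uv; rewrite e4; clear; lia.
  by rewrite e4.
apply: leq_trans (card_inj_le gi) _.
rewrite !card_prod !card_ord card_bool leq_mul2l; apply/orP; right; clear.
by rewrite leq_eqVlt; apply/orP; left; apply/eqP; ring.
Qed.

Lemma card_base : (#|base_set| <= (2 * c).+1 * ((2 * D + 6) * r ^ 3))%N.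
Proof.
have -> : ((2 * c).+1 * ((2 * D + 6) * r ^ 3) =
  (2 * c).+1 * (4 * r ^ 3) + (2 * c).+1 * (2 * D.+1 * r ^ 3))%N by ring.
rewrite -(cardID [pred t | prod2 t == 0]) leq_add//.
  apply: leq_trans card_base_degenerate; rewrite leq_eqVlt; apply/orP; left; apply/eqP.
  by apply: eq_card => t; rewrite !inE andbC.
apply: leq_trans card_base_generic; rewrite leq_eqVlt; apply/orP; left; apply/eqP.
by apply: eq_card => t; rewrite !inE andbC.
Qed.

End BaseCount.

(** * From weighted means to solution counts *)

Definition sum3 (g : nat -> nat) m l (t : 'I_l * 'I_l * 'I_l) : nat :=
  (g (m + t.1.1) + g (m + t.1.2) + g (m + t.2))%N.

(** The one-sided interval for the difference of the k-th powers allows a shift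
    [T] without subtraction of natural numbers. *)
Definition window_solution k m l W T
    (t : ('I_l * 'I_l * 'I_l) * ('I_l * 'I_l * 'I_l)) : bool :=
  (sum3 (expn^~ 2%N) m t.1 == sum3 (expn^~ 2%N) m t.2) &&
  (sum3 (expn^~ k) m t.1 + T <= sum3 (expn^~ k) m t.2 <
     sum3 (expn^~ k) m t.1 + T + W)%N.

Section MeanCounts.
Variables (R : realType) (j Q M H Y X : nat).
Local Notation k := j.+3.
Local Notation f := (freq k Q).
Local Notation mean := (@mean R M H).
Local Notation window_norm := (@window_norm R j Q M).
Hypothesis nc : no_carry k Q M H X.

Let M0 : (0 < M)%N. Proof. by case/andP: nc => _; case: M. Qed.

Local Notation T3 l := ('I_l * 'I_l * 'I_l)%type.

Let fam m l (t : T3 l * 'I_H) : nat := (sum3 f m t.1 + t.2)%N.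

Let fam_lt m l t : (m + l <= X)%N -> (@fam m l t < M)%N.
Proof.
move=> mX; have /andP[_ hM] := nc.
have F (i : 'I_l) : (f (m + i) <= f X)%N.
  by apply: freq_mono; apply: leq_trans mX; rewrite leq_add2l ltnW.
have := F t.1.1.1; have := F t.1.1.2; have := F t.1.2; have := ltn_ord t.2.
by rewrite /fam /sum3; move: hM; clear; lia.
Qed.

Lemma sum3_freq m l (t : T3 l) :
  sum3 f m t = (sum3 (expn^~ k) m t + Q * sum3 (expn^~ 2%N) m t)%N.
Proof. by rewrite /sum3 /freq !mulnDr; ring. Qed.

Lemma mean_window_norm6 m l :
  mean (fun t => window_norm m l t ^+ 6)
    = \sum_(t < M) normc (charsum R (@fam m l) t) ^+ 2.
Proof.
apply: eq_bigr => t _.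
have -> : charsum R (@fam m l) t = window_sum R j Q m l t * window_sum R j Q m l t * window_sum R j Q m l t * dirichlet R H t.
  by rewrite /window_sum /dirichlet !charsumM.
by rewrite !normcM /window_norm; ring.
Qed.

Lemma sum3_pow_lt m l (t : T3 l) (h : 'I_H) : (m + l <= X)%N ->
  (sum3 (expn^~ k) m t + h < Q)%N.
Proof.
move=> mX; have /andP[hQ _] := nc.
have F (i : 'I_l) : ((m + i) ^ k <= X ^ k)%N.
  by rewrite leq_exp2r//; apply: leq_trans mX; rewrite leq_add2l ltnW.
exact: sum3_lt (F t.1.1) (F t.1.2) (F t.2) (ltn_ord h) hQ.
Qed.

(** A solution with difference [T + d], [d < W], is a coincidence of the families
    augmented by the indices [d + w] and [w] of the kernel, for each [w < W]; both
    are below [H = 2 W]. *)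
Lemma count_le_mean m l W T : (m + l <= X)%N -> H = (2 * W)%N ->
  (3 * f X + H + T < M)%N ->
  (M * (W * #|@window_solution k m l W T|))%:R
   <= mean (fun t : 'I_M => window_norm m l t ^+ 6).
Proof.
move=> mX HW hT; rewrite mean_window_norm6.
set A := @window_solution k m l W T.
have hx t : (@fam m l t + T < M)%N.
  have F (i : 'I_l) : (f (m + i) <= f X)%N.
    by apply: freq_mono; apply: leq_trans mX; rewrite leq_add2l ltnW.
  have := F t.1.1.1; have := F t.1.1.2; have := F t.1.2; have := ltn_ord t.2.
  by rewrite /fam /sum3; move: hT; clear; lia.
apply: le_trans (shifted_count R M0 hx); rewrite ler_nat leq_mul//.
rewrite mulnC -[in X in (_ * X <= _)%N](card_ord W).
have -> : (#|A| * #|'I_W| = #|[pred u : (T3 l * T3 l) * 'I_W | A u.1]|)%N.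
  rewrite -[#|'I_W|]/(#|predT|) -cardX; apply: eq_card => u; by rewrite !inE andbT.
have H0 (w : 'I_W) : (0 < H)%N by rewrite HW; have := ltn_ord w; lia.
pose dlt (t : T3 l * T3 l) := (sum3 (expn^~ k) m t.2 - (sum3 (expn^~ k) m t.1 + T))%N.
have hlt (u : (T3 l * T3 l) * 'I_W) : A u.1 -> (dlt u.1 + u.2 < H)%N.
  rewrite /A /window_solution => /andP[_ /andP[h1 h2]]; rewrite HW /dlt; have := ltn_ord u.2.
  by move: h1 h2; clear; lia.
have Wlt (u : (T3 l * T3 l) * 'I_W) : (u.2 < H)%N.
  by rewrite HW; have := ltn_ord u.2; clear; lia.
pose g (u : (T3 l * T3 l) * 'I_W) : (T3 l * 'I_H) * (T3 l * 'I_H) :=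
  ((u.1.1, insubd (Ordinal (Wlt u)) (dlt u.1 + u.2)%N), (u.1.2, Ordinal (Wlt u))).
apply: (@card_inj_le_in _ _ _ _ g).
  move=> [[t1 t2] w] [[t1' t2'] w'] _ _ [-> _ -> ww].
  by congr (_, _); apply: val_inj.
move=> [[t1 t2] w]; rewrite !inE => Au.
rewrite /g /fam /= val_insubd (hlt (t1, t2, w) Au) /dlt /=.
have := Au; rewrite /A /window_solution => /andP[/eqP/= e2 /andP[/= h1 h2]].
rewrite !sum3_freq e2; apply/eqP; move: h1; clear; lia.
Qed.

Hypothesis Y0 : (0 < Y)%N.

(** The tangent line of [t ^ k] at [m] approximates the k-th powers with an error
    comparable to [H], so a coincidence forces a bounded drift. *)
Lemma base_mean r c D m : (forall n, (0 < n <= 2 * r ^ 2)%N -> (size (divisors n) <= D)%N) ->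
  (Y <= m)%N -> (m + r <= X)%N ->
  (H + 3 * (k * j.+2 * (r ^ 2 * X ^ j.+1)) <= c * (k * Y ^ j.+2))%N ->
  mean (fun t : 'I_M => window_norm m r t ^+ 6)
    <= (M * (H * ((2 * c).+1 * ((2 * D + 6) * r ^ 3))))%:R :> R.
Proof.
move=> hD Ym mX hc; rewrite mean_window_norm6 (parseval_norm R M0); last first.
  by move=> t; exact: fam_lt.
rewrite ler_nat leq_mul2l; apply/orP; right.
apply: (@leq_trans #|[pred u : (T3 r * T3 r) * 'I_H | base_set c m%:Z u.1]|); last first.
  have -> : #|[pred u : (T3 r * T3 r) * 'I_H | base_set c m%:Z u.1]|
     = (#|[pred t | base_set (r := r) c m%:Z t]| * #|'I_H|)%N.
    by rewrite -[#|'I_H|]/(#|predT|) -cardX; apply: eq_card => u; rewrite !inE andbT.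
  by rewrite card_ord mulnC leq_mul2l (card_base _ _ hD) orbT.
pose g (p : (T3 r * 'I_H) * (T3 r * 'I_H)) := ((p.1.1, p.2.1), p.1.2).
have split_eq p : @fam m r p.1 == @fam m r p.2 ->
    sum3 (expn^~ 2%N) m p.1.1 = sum3 (expn^~ 2%N) m p.2.1 /\
    (sum3 (expn^~ k) m p.1.1 + p.1.2 = sum3 (expn^~ k) m p.2.1 + p.2.2)%N.
  case: p => [[t1 h1] [t2 h2]] /eqP; rewrite /fam /= !sum3_freq => E.
  by apply: (@freq_separates Q) => //; apply: sum3_pow_lt.
apply: (@card_inj_le_in _ _ _ _ g).
  move=> p p'; rewrite !inE => /(split_eq p)[_ +] /(split_eq p')[_ +].
  case: p p' => [[t1 h1] [t2 h2]] [[t1' h1'] [t2' h2']] /= e e' [t1E t2E hE].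
  subst t1' t2' h1'.
  by congr (_, (_, _)); apply: val_inj => /=; move: e e'; clear; lia.
move=> p; rewrite !inE => /(split_eq p)[].
case: p => [[t1 h1] [t2 h2]] /= e2 ek; clear g split_eq; case: t1 e2 ek => [[i1 i2] i3]; case: t2 => [[i4 i5] i6].
rewrite /sum3 /= => e2 ek; rewrite /base_set; apply/andP; split; last first.
  apply/eqP; rewrite /drift /drift2 /=; move: e2; rewrite !expr2 -!mulnn; clear.
  by move=> /(congr1 Posz); rewrite !PoszD !PoszM !PoszD => e2; nia.
pose a (i : 'I_r) : R := (m + i)%:R ^+ k - m%:R ^+ k - k%:R * (i%:R * m%:R ^+ j.+2).
pose U : R := k%:R * j.+2%:R * (r%:R ^+ 2 * X%:R ^+ j.+1).
have aU i : 0 <= a i <= U.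
  have := @tangent_error R j.+1 (m + i)%:R m%:R.
  rewrite ler0n ler_nat leq_addr => /(_ isT).
  have -> : (m + i)%:R - m%:R = i%:R :> R by rewrite natrD; ring.
  move=> /andP[-> le1] /=; apply: le_trans le1 _; rewrite /U ler_wpM2l ?mulr_ge0//.
  apply: ler_pM; rewrite ?exprn_ge0//; first by rewrite lerXn2r ?nnegrE// ler_nat ltnW.
  rewrite lerXn2r ?nnegrE// ler_nat; apply: leq_trans mX; rewrite leq_add2l ltnW//.
pose d : int := drift ((i1, i2, i3), (i4, i5, i6)).
have dE : d%:~R = i1%:R + i2%:R + i3%:R - (i4%:R + i5%:R + i6%:R) :> R.
  by rewrite /d /drift /= !rmorphB !rmorphD.
have ekR : (m + i1)%:R ^+ k + (m + i2)%:R ^+ k + (m + i3)%:R ^+ k + h1%:R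
  = (m + i4)%:R ^+ k + (m + i5)%:R ^+ k + (m + i6)%:R ^+ k + h2%:R :> R.
  by rewrite -!natrX -!natrD ek.
have key : k%:R * m%:R ^+ j.+2 * d%:~R = h2%:R - h1%:R
   + (a i4 + a i5 + a i6) - (a i1 + a i2 + a i3) :> R.
  by rewrite dE /a; move: ekR; set z1 := _ ^+ k; lra.
have hcR : H%:R + 3 * U <= c%:R * (k%:R * Y%:R ^+ j.+2) :> R.
  rewrite /U -!natrX -!natrM -natrD ler_nat; apply: leq_trans hc; rewrite leq_add2l.
  by rewrite leq_eqVlt; apply/orP; left; apply/eqP; ring.
have hh (h : 'I_H) : 0 <= h%:R :> R /\ h%:R < H%:R :> R.
  by rewrite ler0n ltr_nat.
have le_key : `|k%:R * m%:R ^+ j.+2 * d%:~R| <= c%:R * (k%:R * m%:R ^+ j.+2) :> R.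
  apply: (@le_trans _ _ (H%:R + 3 * U)); last first.
    apply: le_trans hcR _; rewrite ler_wpM2l// ler_wpM2l// lerXn2r ?nnegrE//.
    by rewrite ler_nat.
  rewrite key ler_norml.
  have := aU i1; have := aU i2; have := aU i3; have := aU i4; have := aU i5; have := aU i6.
  by have := hh h1; have := hh h2; clear; lra.
have km0 : 0 < k%:R * m%:R ^+ j.+2 :> R.
  by rewrite mulr_gt0// exprn_gt0// ltr0n (leq_trans Y0).
move: le_key; rewrite normrM (gtr0_norm km0) mulrC ler_pM2r// => le_d.
rewrite -/d -(ler_nat R); move: le_d; rewrite -intr_norm; congr (_ <= _).
Qed.

End MeanCounts.

(** * The count of solutions in a long window *)

Lemma isqrt_exists Y : (0 < Y)%N ->
  exists r, [/\ (0 < r)%N, (r ^ 2 <= Y)%N & (Y <= 4 * r ^ 2)%N].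
Proof.
move=> Y0; suff [r /andP[r1 r2]] : exists r, (r ^ 2 <= Y < r.+1 ^ 2)%N.
  exists r; have r0 : (0 < r)%N by case: r r1 r2 => //; lia.
  by split=> //; nia.
elim: Y {Y0} => [|Y [r /andP[r1 r2]]]; first by exists 0%N.
have [h|h] := leqP (r.+1 ^ 2) Y.+1; last by exists r; rewrite h andbT; lia.
by exists r.+1; rewrite h/=; nia.
Qed.

Section CoreCount.
Variables (R : realType).

Lemma root_le (n x Z : nat) : (x ^ n.+1 <= Z)%N ->
  (x <= Num.truncn ((Z%:R : R) `^ n.+1%:R^-1))%N.
Proof.
move=> h; rewrite -(ler_nat R) in h; rewrite truncn_ge_nat; last exact: powR_ge0.
have -> : x%:R = (x%:R ^+ n.+1) `^ n.+1%:R^-1 :> R.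
  by rewrite -powR_mulrn// -powRrM divff ?powRr1.
by rewrite ge0_ler_powR ?nnegrE// -natrX.
Qed.

(** All parameters are explicit: [r] is about the square root of [Y], [r s ^ p] is the
    largest such length below [Y], and the window of length [kappa * Y] is covered
    by at most [kappa * s + 1] windows of that length.  The remaining powers are
    compared with [Y] in [core_count]. *)
Lemma core_bound j (kappa C n K s Y W T : nat) (theta sigma : R) :
  (0 < Y)%N -> (0 < W)%N -> (W <= C * Y ^ j.+2)%N ->
  (forall n0, (0 < n0)%N -> size (divisors n0) ^ n.+1 <= K * n0)%N ->
  (128 <= s)%N -> (8 * C + 2 * j.+3 * j.+1 * (kappa + 2) ^ j.+1 <= s)%N ->
  1 <= theta -> theta <= sigma -> theta ^+ (2 ^ n.+2) = s%:R ->
  s%:R ^+ 5 <= sigma ^+ n.+2 ->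
  exists L r p : nat, [/\ (kappa * Y <= L)%N, (0 < r)%N, (r * s ^ p <= Y)%N &
   #|@window_solution j.+3 Y L W T|%:R <=
     (kappa * s).+1%:R ^+ 6 * (36 * s%:R ^+ 13) ^+ (3 * 2 ^ n.+2) *
     (2 * (2 * (8 * C + 3 * (j.+2 * (kappa + 2) ^ j.+1))).+1%:R) *
     (sigma ^+ p * (2 * (K * (2 * Y))%:R `^ n.+1%:R^-1 + 6) * (r * s ^ p)%:R ^+ 3)].
Proof.
move=> Y0 W0 hW hK s128 hs th1 ths thS Ss.
have [r [r0 rY Yr]] := isqrt_exists Y0.
set X := ((kappa + 2) * Y)%N; set H := (2 * W)%N.
set Q := (3 * X ^ j.+3 + H).+1; set M := (3 * freq j.+3 Q X + H + T).+1.
have nc : no_carry j.+3 Q M H X.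
  by rewrite /no_carry /Q /M !ltnS leqnn/= leq_addr.
have hH : (H <= 8 * C * (Y ^ j.+1 * r ^ 2))%N.
  have -> : (8 * C * (Y ^ j.+1 * r ^ 2) = 2 * (C * (Y ^ j.+1 * (4 * r ^ 2))))%N by ring.
  rewrite /H leq_mul2l/=; apply: leq_trans hW _.
  by rewrite leq_mul2l expnSr leq_mul2l Yr !orbT.
have res : resolves j.+3 H X Y s r by apply: resolvesP hs.
pose D := Num.truncn ((K * (2 * Y))%:R `^ n.+1%:R^-1 : R).
have hD n0 : (0 < n0 <= 2 * r ^ 2)%N -> (size (divisors n0) <= D)%N.
  move=> /andP[n00 n0r]; apply: root_le; apply: leq_trans (hK _ n00) _.
  by rewrite leq_mul2l (leq_trans n0r) ?orbT// leq_mul2l rY.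
set c := (8 * C + 3 * (j.+2 * (kappa + 2) ^ j.+1))%N.
have hc : (H + 3 * (j.+3 * j.+2 * (r ^ 2 * X ^ j.+1)) <= c * (j.+3 * Y ^ j.+2))%N.
  have rYj : (Y ^ j.+1 * r ^ 2 <= Y ^ j.+2)%N by rewrite [(Y ^ j.+2)%N]expnSr leq_mul2l rY orbT.
  rewrite /c mulnDl; apply: leq_add.
    apply: leq_trans hH _; rewrite leq_mul2l; apply/orP; right.
    by apply: leq_trans rYj _; rewrite leq_pmull.
  have -> : (3 * (j.+3 * j.+2 * (r ^ 2 * X ^ j.+1)) =
    3 * j.+3 * j.+2 * ((kappa + 2) ^ j.+1 * (Y ^ j.+1 * r ^ 2)))%N by rewrite /X expnMn; ring.
  have -> : (3 * (j.+2 * (kappa + 2) ^ j.+1) * (j.+3 * Y ^ j.+2) =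
    3 * j.+3 * j.+2 * ((kappa + 2) ^ j.+1 * Y ^ j.+2))%N by ring.
  by rewrite !leq_mul2l rYj !orbT.
pose B : R := (M * (H * ((2 * c).+1 * ((2 * D + 6) * r ^ 3))))%:R.
have B0 : 0 <= B by exact: ler0n.
have base : sixth_bound j Q M H Y X r s B 0 1.
  move=> m; rewrite expn0 muln1 muln0 expr0 !mul1r => /andP[Ym mX].
  exact: (base_mean R nc Y0 hD Ym mX hc).
have dec := decoupling Y0 nc r0 s128 res B0 base th1 ths thS Ss.
pose p := trunc_log s (Y %/ r).
have Yr0 : (0 < Y %/ r)%N.
  by rewrite divn_gt0//; apply: leq_trans rY; rewrite -mulnn leq_pmull.
have s1 : (1 < s)%N by exact: leq_trans s128.
have /andP[p1 p2] := trunc_log_bounds s1 Yr0; rewrite -/p in p1 p2.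
set len := (r * s ^ p)%N.
have lenY : (len <= Y)%N by rewrite /len mulnC -leq_divRL.
have len0 : (0 < len)%N by rewrite muln_gt0 r0 expn_gt0 (ltnW s1).
have Ylen : (Y < s * len)%N by rewrite /len mulnCA -expnS mulnC -ltn_divLR.
pose q := (kappa * Y %/ len).+1.
have qY : (kappa * Y <= q * len)%N by rewrite ltnW// /q ltn_ceil.
have qX : (Y + q * len <= X)%N.
  rewrite /q /X mulSn mulnDl.
  have := leq_divM (kappa * Y) len; move: lenY; clear; lia.
have q_le : (q <= (kappa * s).+1)%N.
  rewrite /q ltnS -(mulnK (kappa * s) len0) leq_div2r// -mulnA leq_mul2l ltnW ?orbT//.
exists (q * len)%N, r, p; split=> //.
set E := (36 * _) ^+ _ in dec *.
have := @count_le_mean R j Q M H X nc Y (q * len) W T qX erefl (leqnn _).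
set N := #|_| => le1.
have le2 : mean H (fun t : 'I_M => window_norm R j Q Y (q * len) t ^+ 6)
    <= q%:R ^+ 6 * (E * sigma ^+ p * s%:R ^+ (3 * p) * B).
  apply: (@le_trans _ _ (mean H (fun t : 'I_M => q%:R ^+ 5 * \sum_(i < q)
     window_norm R j Q (Y + i * len) len t ^+ 6))).
    by apply: le_mean => t; exact: window_norm_split_le.
  rewrite meanZ mean_sum (exprSr q%:R 5) -[leRHS]mulrA ler_wpM2l ?exprn_ge0//.
  rewrite mulr_natl -[X in _ *+ X]card_ord -sumr_const.
  apply: ler_sum => i _; apply: dec; apply: admissible_sub.
  by rewrite /admissible leqnn.
have {le1 le2} := le_trans le1 le2.
have -> : q%:R ^+ 6 * (E * sigma ^+ p * s%:R ^+ (3 * p) * B)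
  = (M * W)%:R * (q%:R ^+ 6 * E * (2 * (2 * c).+1%:R) *
      (sigma ^+ p * (2 * D%:R + 6) * len%:R ^+ 3)).
  have -> : s%:R ^+ (3 * p) = (s%:R ^+ p) ^+ 3 :> R by rewrite -exprM mulnC.
  by rewrite /B /H /len !(natrM, natrD, natrX); ring.
rewrite mulnA natrM ler_pM2l ?ltr0n ?muln_gt0 ?W0//.
move=> /le_trans; apply.
have sg0 : 0 <= sigma by rewrite (le_trans _ ths)// (le_trans _ th1).
have E0 : 0 <= E by rewrite exprn_ge0// mulr_ge0// exprn_ge0.
have D_le : D%:R <= (K * (2 * Y))%:R `^ n.+1%:R^-1 :> R.
  by rewrite truncn_le// powR_ge0.
apply: ler_pM.
- by rewrite !mulr_ge0 ?exprn_ge0.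
- by rewrite !mulr_ge0 ?exprn_ge0// addr_ge0// mulr_ge0.
- rewrite ler_wpM2r ?mulr_ge0// ler_wpM2r// lerXn2r ?nnegrE// ler_nat//.
rewrite ler_wpM2r ?exprn_ge0// ler_wpM2l ?exprn_ge0// lerD2r ler_wpM2l//.
Qed.

(** With [sigma = s ^ (eps / 2)] and [n >= 10 / eps] the gain condition of the
    bootstrap holds, and the exponent [1 / n.+1] of the divisor bound is below
    [eps / 2].  All constants depend on [n] and [s] only. *)
Lemma core_count j (kappa C : nat) (eps : R) : 0 < eps ->
  exists2 A : R, 0 <= A & forall Y W T, (0 < Y)%N -> (0 < W)%N ->
    (W <= C * Y ^ j.+2)%N ->
    exists2 L, (kappa * Y <= L)%N &
      #|@window_solution j.+3 Y L W T|%:R <= A * Y%:R `^ (3 + eps).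
Proof.
move=> eps0.
pose n := Num.bound (10 / eps).
have hn : 10 <= n%:R * eps.
  rewrite -ler_pdivrMr// ltW// /n; apply: archi_boundP.
  by rewrite divr_ge0// ltW.
have [K hK] := divisor_bound (ltn0Sn n).
set s := (128 + (8 * C + 2 * j.+3 * j.+1 * (kappa + 2) ^ j.+1))%N.
have S1 : 1 <= s%:R :> R by rewrite ler1n.
have S0 : 0 <= s%:R :> R by exact: ler0n.
pose theta : R := s%:R `^ ((2 ^ n.+2)%:R^-1).
pose sigma : R := s%:R `^ (eps / 2).
have pow2 : n%:R <= (2 ^ n.+2)%:R :> R.
  by rewrite ler_nat ltnW// (leq_trans (ltn_expl n (ltnSn 1)))// leq_exp2l// leqW.
have eps_ge (x : R) : n%:R <= x -> x^-1 <= eps / 2.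
  move=> nx; have x0 : 0 < x by nra.
  rewrite -(mulr1 x^-1) ler_pdivrMl//; nra.
have th1 : 1 <= theta by rewrite -(powRr0 s%:R) ler_powR// invr_ge0.
have ths : theta <= sigma by rewrite ler_powR// eps_ge.
have thS : theta ^+ (2 ^ n.+2) = s%:R.
  have P0 : (2 ^ n.+2)%:R != 0 :> R by rewrite pnatr_eq0 expn_eq0.
  by rewrite -powR_mulrn ?powR_ge0// -powRrM mulVf// powRr1.
have Ss : s%:R ^+ 5 <= sigma ^+ n.+2.
  rewrite -(powR_mulrn 5 S0) -(powR_mulrn n.+2 (powR_ge0 _ _)) -powRrM ler_powR//.
  by rewrite -addn2 natrD; nra.
pose a : R := (K * 2)%:R `^ n.+1%:R^-1.
have a0 : 0 <= a by exact: powR_ge0.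
set c : R := (kappa * s).+1%:R ^+ 6 * (36 * s%:R ^+ 13) ^+ (3 * 2 ^ n.+2) *
     (2 * (2 * (8 * C + 3 * (j.+2 * (kappa + 2) ^ j.+1))).+1%:R).
have c0 : 0 <= c.
  have c1 : 0 <= (36 * s%:R ^+ 13) ^+ (3 * 2 ^ n.+2) :> R.
    by rewrite exprn_ge0// mulr_ge0// exprn_ge0.
  by rewrite /c mulr_ge0// mulr_ge0// exprn_ge0.
exists (c * (2 * a + 6)).
  by rewrite mulr_ge0// addr_ge0// mulr_ge0.
move=> Y W T Y0 W0 hW.
have [L [r [p [hL r0 rsY le1]]]] := core_bound T Y0 W0 hW hK (leq_addr _ _)
  (leq_addl _ _) th1 ths thS Ss.
exists L => //; apply: le_trans le1 _; rewrite -/c -[leRHS]mulrA ler_wpM2l//.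
have Y1 : 1 <= Y%:R :> R by rewrite ler1n.
have Yn0 : Y%:R != 0 :> R by rewrite pnatr_eq0 -lt0n.
set y : R := Y%:R `^ (eps / 2).
have y1 : 1 <= y by rewrite -(powRr0 Y%:R) ler_powR// divr_ge0// ltW.
have spY : sigma ^+ p <= y.
  rewrite -powR_mulrn ?powR_ge0// powRAC powR_mulrn// ge0_ler_powR ?nnegrE ?exprn_ge0//.
    by rewrite divr_ge0// ltW.
  by rewrite -natrX ler_nat; apply: leq_trans rsY; rewrite leq_pmull.
have dY : (K * (2 * Y))%:R `^ n.+1%:R^-1 <= a * y.
  by rewrite mulnA natrM powRM// ler_wpM2l// ler_powR// eps_ge// ler_nat leqnSn.
have -> : (2 * a + 6) * Y%:R `^ (3 + eps) = y * ((2 * a + 6) * y) * Y%:R ^+ 3.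
  have -> : 3 + eps = 3 + eps / 2 + eps / 2 by field.
  have D (x z : R) : Y%:R `^ (x + z) = Y%:R `^ x * Y%:R `^ z.
    by rewrite powRD// Yn0 implybT.
  by rewrite (D (3 + eps / 2)) (D 3) -/y (powR_mulrn 3)//; ring.
have sp0 : 0 <= sigma ^+ p by rewrite exprn_ge0 ?powR_ge0.
move: dY; set x := (K * (2 * Y))%:R `^ _ => dY.
have x0 : 0 <= x by exact: powR_ge0.
have x6 : 0 <= 2 * x + 6 by rewrite addr_ge0// mulr_ge0.
apply: ler_pM; rewrite ?exprn_ge0 ?mulr_ge0//.
  by apply: ler_pM => //; nra.
by rewrite lerXn2r ?nnegrE// ler_nat.
Qed.

End CoreCount.

Lemma window_solution_widen k m l L W T : (l <= L)%N ->
  (#|@window_solution k m l W T| <= #|@window_solution k m L W T|)%N.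
Proof.
move=> lL; pose wd := widen_ord lL.
have wd_inj : injective wd by move=> i i' /(congr1 val) h; apply: val_inj.
pose wd3 (t : 'I_l * 'I_l * 'I_l) := (wd t.1.1, wd t.1.2, wd t.2).
apply: (@card_inj_le_in _ _ _ _ (fun t => (wd3 t.1, wd3 t.2))) => //.
move=> [[[a1 a2] a3] [[a4 a5] a6]] [[[b1 b2] b3] [[b4 b5] b6]] _ _.
by rewrite /wd3 /= => -[] /val_inj-> /val_inj-> /val_inj-> /val_inj-> /val_inj-> /val_inj->.
Qed.

Lemma window_count (R : realType) j (kappa C : nat) (eps : R) : 0 < eps ->
  exists2 A : R, 0 <= A & forall Y W T, (0 < Y)%N -> (0 < W)%N ->
    (W <= C * Y ^ j.+2)%N ->
    #|@window_solution j.+3 Y (kappa * Y) W T|%:R <= A * Y%:R `^ (3 + eps).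
Proof.
move=> eps0; have [A A0 hA] := core_count j kappa C eps0.
exists A => // Y W T Y0 W0 hW; have [L hL le1] := hA Y W T Y0 W0 hW.
by apply: le_trans le1; rewrite ler_nat window_solution_widen.
Qed.

Lemma window_count_abs (R : realType) j (kappa C : nat) (eps : R) : 0 < eps ->
  exists2 A : R, 0 <= A & forall Y W T, (0 < Y)%N -> (0 < W)%N ->
    (W <= C * Y ^ j.+2)%N ->
    #|[pred t | @window_solution j.+3 Y (kappa * Y) W T t ||
        window_solution j.+3 Y W T (t.2, t.1)]|%:R <= A * Y%:R `^ (3 + eps).
Proof.
move=> eps0; have [A A0 hA] := window_count j kappa C eps0.
exists (A + A); first exact: addr_ge0.
move=> Y W T Y0 W0 hW; have h := hA Y W T Y0 W0 hW.
set P := @window_solution j.+3 Y (kappa * Y) W T in h *.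
have le1 : (#|[pred t | P t || P (t.2, t.1)]| <= #|P| + #|P|)%N.
  apply: (@leq_trans (#|P| + #|[pred t | P (t.2, t.1)]|)).
    by rewrite -cardUI (eq_card (B := [predU P & [pred t | P (t.2, t.1)]])) ?leq_addr//.
  rewrite leq_add2l; apply: (@card_inj_le_in _ _ _ _ (fun t => (t.2, t.1))) => //.
  by move=> [a b] [c d] _ _ /= [-> ->].
apply: (@le_trans _ _ (#|P| + #|P|)%:R); first by rewrite ler_nat.
by rewrite natrD mulrDl lerD.
Qed.

(** * Integrals of trigonometric sums *)

Local Open Scope classical_set_scope.
Local Open Scope ring_scope.

Section TrigIntegral.
Variable R : realType.
Local Notation mu := (@lebesgue_measure R).

Lemma is_derive_continuous (f : R -> R) (df : R -> R) :
  (forall x : R, is_derive x 1 f (df x)) -> continuous f.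
Proof.
move=> h x; apply: differentiable_continuous; apply/derivable1_diffP.
by case: (h x).
Qed.

Lemma integral_is_derive (F f : R -> R) a b : a < b ->
  (forall x : R, is_derive x 1 F (f x)) -> continuous f ->
  (\int[mu]_(x in `[a, b]) (f x)%:E)%E = (F b - F a)%:E.
Proof.
move=> ab dF cf; have cF : continuous F by exact: is_derive_continuous dF.
rewrite (@continuous_FTC2 _ f F)//.
- exact: continuous_subspaceT.
- split=> [x _||].
  + by case: (dF x).
  + by apply: cvg_at_right_filter; exact: cF.
  + by apply: cvg_at_left_filter; exact: cF.
- by move=> x _; rewrite derive1E; have := dF x; case => _ ->.
Qed.

(** A primitive of [cos (2 pi D x)], including the constant term [D = 0]. *)
Definition cos_prim (D x : R) : R :=
  if D == 0 then x else sin (2 * pi * D * x) / (2 * pi * D).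

Definition sin_prim (D x : R) : R :=
  if D == 0 then 0 else - cos (2 * pi * D * x) / (2 * pi * D).

Lemma is_derive_scale (c x : R) : is_derive x 1 (fun y => c * y) c.
Proof.
have := @is_deriveZ R R R id c x 1 1 (is_derive_id _ _).
by rewrite /GRing.scale /= mulr1.
Qed.

Lemma is_derive_sin_scale (c x : R) :
  is_derive x 1 (fun y => sin (c * y)) (c * cos (c * x)).
Proof.
have h := is_derive_scale c x.
have := @is_derive1_comp R (@sin R) (fun y => c * y) x _ _ (is_derive_sin _) h.
by rewrite mulrC.
Qed.

Lemma is_derive_cos_scale (c x : R) :
  is_derive x 1 (fun y => cos (c * y)) (- (c * sin (c * x))).
Proof.
have h := is_derive_scale c x.
have := @is_derive1_comp R (@cos R) (fun y => c * y) x _ _ (is_derive_cos _) h.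
by rewrite mulNr mulrC.
Qed.

Lemma is_derive_cos_prim (D x : R) :
  is_derive x 1 (cos_prim D) (cos (2 * pi * D * x)).
Proof.
have [->|D0] := eqVneq D 0.
  rewrite mulr0 mul0r cos0; have -> : cos_prim 0 = id by apply/funext => y; rewrite /cos_prim eqxx.
  exact: is_derive_id.
have c0 : 2 * pi * D != 0 :> R by rewrite !mulf_neq0// gt_eqF// pi_gt0.
have -> : cos_prim D = (fun y => (2 * pi * D)^-1 * sin (2 * pi * D * y)).
  by apply/funext => y; rewrite /cos_prim (negbTE D0) mulrC.
have := @is_deriveZ R R R (fun y => sin (2 * pi * D * y)) (2 * pi * D)^-1 x 1 _
  (is_derive_sin_scale (2 * pi * D) x).
by rewrite /GRing.scale /= mulKf.
Qed.

Lemma is_derive_sin_prim (D x : R) :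
  is_derive x 1 (sin_prim D) (sin (2 * pi * D * x)).
Proof.
have [->|D0] := eqVneq D 0.
  rewrite mulr0 mul0r sin0; have -> : sin_prim 0 = cst 0 by apply/funext => y; rewrite /sin_prim eqxx.
  exact: is_derive_cst.
have c0 : 2 * pi * D != 0 :> R by rewrite !mulf_neq0// gt_eqF// pi_gt0.
have -> : sin_prim D = (fun y => - (2 * pi * D)^-1 * cos (2 * pi * D * y)).
  by apply/funext => y; rewrite /sin_prim (negbTE D0) !mulNr mulrC.
have := @is_deriveZ R R R (fun y => cos (2 * pi * D * y)) (- (2 * pi * D)^-1) x 1 _
  (is_derive_cos_scale (2 * pi * D) x).
by rewrite /GRing.scale /= mulrNN mulKf.
Qed.

Lemma trig_integral (T : finType) (p q D : T -> R) a b : a < b ->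
  (\int[mu]_(x in `[a, b])
     (\sum_t (p t * cos (2 * pi * D t * x) + q t * sin (2 * pi * D t * x)))%:E)%E
  = (\sum_t (p t * (cos_prim (D t) b - cos_prim (D t) a)
          + q t * (sin_prim (D t) b - sin_prim (D t) a)))%:E.
Proof.
move=> ab.
pose ev (i : 'I_#|T|) := enum_val i.
pose F (x : R) := \sum_t (p t * cos_prim (D t) x + q t * sin_prim (D t) x).
pose f (x : R) := \sum_t (p t * cos (2 * pi * D t * x) + q t * sin (2 * pi * D t * x)).
pose g (x : R) := \sum_t (q t * (2 * pi * D t * cos (2 * pi * D t * x))
   - p t * (2 * pi * D t * sin (2 * pi * D t * x))).
have der (u v : T -> R -> R) : (forall t (x : R), is_derive x 1 (u t) (v t x)) ->
    forall x : R, is_derive x 1 (fun y => \sum_t u t y) (\sum_t v t x).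
  move=> uv x; have := @is_derive_sum R R R #|T| (fun i => u (ev i)) x 1 (fun i => v (ev i) x)
    (fun i => uv (ev i) x).
  have E (w : T -> R) : \sum_t w t = \sum_(i < #|T|) w (ev i) by rewrite big_enum_val.
  rewrite E; have -> : (fun y => \sum_t u t y) = \sum_(i < #|T|) u (ev i).
    by apply/funext => y; rewrite fct_sumE E.
  by [].
have dF (x : R) : is_derive x 1 F (f x).
  apply: (der (fun t x => p t * cos_prim (D t) x + q t * sin_prim (D t) x)
    (fun t x => p t * cos (2 * pi * D t * x) + q t * sin (2 * pi * D t * x))) => t y.
  have h1 := is_derive_cos_prim (D t) y; have h2 := is_derive_sin_prim (D t) y.
  have := is_deriveD (is_deriveZ (p t) h1) (is_deriveZ (q t) h2).
  by [].
have df (x : R) : is_derive x 1 f (g x).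
  apply: (der (fun t x => p t * cos (2 * pi * D t * x) + q t * sin (2 * pi * D t * x))
    (fun t x => q t * (2 * pi * D t * cos (2 * pi * D t * x))
       - p t * (2 * pi * D t * sin (2 * pi * D t * x)))) => t y.
  have h1 := is_derive_cos_scale (2 * pi * D t) y; have h2 := is_derive_sin_scale (2 * pi * D t) y.
  set c := 2 * pi * D t in h1 h2 *.
  have -> : q t * (c * cos (c * y)) - p t * (c * sin (c * y))
    = p t * - (c * sin (c * y)) + q t * (c * cos (c * y)) by ring.
  exact: is_deriveD (is_deriveZ (p t) h1) (is_deriveZ (q t) h2).
rewrite (integral_is_derive ab dF (is_derive_continuous df)); congr (_%:E).
rewrite /F -sumrB; apply: eq_bigr => t _; ring.
Qed.

End TrigIntegral.

(** * The sixth moment as a weighted count *)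

Section SixthMoment.
Variable R : realType.

Lemma sin_2pi_nat (n : nat) : sin (2 * pi * n%:R) = 0 :> R.
Proof.
have : e (n%:R : R) = 1 by rewrite -[n%:R]mul1r eMn e1 expr1n.
by rewrite /e => /(congr1 (@complex.Im R)).
Qed.

(** Integer frequencies are orthogonal to constants over the two periods. *)
Lemma cos_prim_period (D1 D2 : nat) :
  cos_prim (D1%:R - D2%:R) 1 - cos_prim (D1%:R - D2%:R) (-1)
    = if D1 == D2 then 2 else 0 :> R.
Proof.
have [->|D12] := eqVneq D1 D2; first by rewrite subrr /cos_prim eqxx; ring.
rewrite /cos_prim subr_eq0 eqr_nat (negbTE D12) mulrN sinN mulr1.
have -> : sin (2 * pi * (D1%:R - D2%:R)) = 0 :> R.
  by rewrite mulrBr sinD cosN sinN !sin_2pi_nat mul0r add0r oppr0 mulr0.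
by rewrite oppr0 mul0r subrr.
Qed.

Lemma sin_prim_period (D : R) : sin_prim D 1 - sin_prim D (-1) = 0.
Proof.
by rewrite /sin_prim; case: ifP => _; rewrite ?subrr// mulrN cosN mulr1 subrr.
Qed.

(** The mean value theorem, the derivative being a cosine. *)
Lemma cos_prim_le_length (D lambda : R) : 0 <= lambda ->
  cos_prim D lambda - cos_prim D 0 <= lambda.
Proof.
move=> l0; have dF := is_derive_cos_prim D.
have [|c _ ->] := MVT_segment l0 (fun x _ => dF x).
  by apply: continuous_subspaceT; exact: is_derive_continuous dF.
by rewrite subr0 ler_piMl// cos_le1.
Qed.

Lemma cos_prim_le_inv (D lambda : R) : D != 0 ->
  cos_prim D lambda - cos_prim D 0 <= `|D|^-1.
Proof.
move=> D0; rewrite /cos_prim (negbTE D0) mulr0 sin0 mul0r subr0.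
apply: (le_trans (ler_norm _)); rewrite normrM normfV.
have D0' : 0 < `|D| by rewrite normr_gt0.
have pi1 : 1 <= 2 * pi :> R by have := @pi_ge2 R; lra.
have -> : `|2 * pi * D| = 2 * pi * `|D| by rewrite normrM ger0_norm// (le_trans ler01).
have l1 : `|sin (2 * pi * D * lambda)| <= 1 by rewrite ler_norml sin_geN1 sin_le1.
have p0 : 0 < 2 * pi :> R by exact: lt_le_trans pi1.
rewrite ler_pdivrMr ?(mulr_gt0 p0)// mulrCA mulVf ?gt_eqF// mulr1.
exact: le_trans pi1.
Qed.

Variables (k : nat) (c1 c2 N lambda : R) (Y l : nat).
Hypothesis lambda0 : 0 <= lambda.
Hypothesis dyadic_sub : forall n, dyadic c1 c2 N n -> exists2 i, (i < l)%N & n = (Y + i)%:Z.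

Local Notation T3 := ('I_l * 'I_l * 'I_l)%type.
Let inA (i : 'I_l) := `[< dyadic c1 c2 N (Y + i)%:Z >].

Lemma expsum_window x y : expsum k c1 c2 N x y =
  \sum_(i < l) if inA i then e (x * (Y + i)%:R ^+ 2 + y * (Y + i)%:R ^+ k) else 0.
Proof.
pose r := [seq (Y + i)%:Z | i : 'I_l <- enum 'I_l & inA i].
have r_uniq : uniq r.
  rewrite map_inj_in_uniq ?filter_uniq -?enumT ?enum_uniq// => i i' _ _ [] /addnI.
  exact: val_inj.
have rE : dyadic c1 c2 N = [set` r].
  apply/seteqP; split => n /=.
    move=> dn; have [i il nE] := dyadic_sub dn; apply/mapP.
    exists (Ordinal il) => //; rewrite mem_filter mem_enum andbT /inA /=.
    by apply/asboolP; rewrite -nE.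
  move=> /mapP[a]; rewrite mem_filter => /andP[+ _] ->; rewrite /inA => /asboolP; exact.
rewrite /expsum rE -fsbig_seq// big_map big_filter big_enum_cond/= big_mkcond/=.
by apply: eq_bigr => i _.
Qed.

Definition quad_gap (t : T3 * T3) : R :=
  (sum3 (expn^~ 2%N) Y t.1)%:R - (sum3 (expn^~ 2%N) Y t.2)%:R.

Definition pow_gap (t : T3 * T3) : R :=
  (sum3 (expn^~ k) Y t.1)%:R - (sum3 (expn^~ k) Y t.2)%:R.

(* Restricts the sextuples to entries in the dyadic range. *)
Let w (t : T3 * T3) : R :=
  ([&& inA t.1.1.1, inA t.1.1.2, inA t.1.2, inA t.2.1.1, inA t.2.1.2 & inA t.2.2])%:R.

Lemma expsum6 x y : normc (expsum k c1 c2 N x y) ^+ 6 =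
  \sum_t w t * cos (2 * pi * (x * quad_gap t + y * pow_gap t)).
Proof.
pose z (i : 'I_l) : R[i] :=
  if inA i then e (x * (Y + i)%:R ^+ 2 + y * (Y + i)%:R ^+ k) else 0.
pose X (t : T3) := z t.1.1 * z t.1.2 * z t.2.
have S3 : expsum k c1 c2 N x y ^+ 3 = \sum_t X t.
  rewrite expsum_window -/(z _) !exprS expr0 mulr1 mulrA.
  rewrite mulr_suml (eq_bigr (fun i => \sum_j z i * z j)); last first.
    by move=> i _; rewrite mulr_sumr.
  rewrite pair_bigA/= mulr_suml (eq_bigr (fun p => \sum_j z p.1 * z p.2 * z j)); last first.
    by move=> i _; rewrite mulr_sumr.
  by rewrite pair_bigA.
rewrite (exprM _ 3 2) -normcX S3 normc_sqr_sum pair_bigA/=; apply: eq_bigr => -[t t'] _ /=.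
have XE (s : T3) : X s = if [&& inA s.1.1, inA s.1.2 & inA s.2] then
    e (x * (sum3 (expn^~ 2%N) Y s)%:R + y * (sum3 (expn^~ k) Y s)%:R) else 0.
  rewrite /X /z; case: (inA s.1.1); rewrite ?mul0r//=.
  case: (inA s.1.2); rewrite ?mulr0 ?mul0r//=; case: (inA s.2); rewrite ?mulr0//=.
  by rewrite -!eD; congr e; rewrite /sum3 !(natrX, natrD); ring.
have -> : w (t, t') = ([&& inA t.1.1, inA t.1.2 & inA t.2]
    && [&& inA t'.1.1, inA t'.1.2 & inA t'.2])%:R by rewrite /w /= -!andbA.
rewrite !XE.
case: [&& inA t.1.1, inA t.1.2 & inA t.2]; last by rewrite !mul0r.
case: [&& inA t'.1.1, inA t'.1.2 & inA t'.2]; last first.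
  by rewrite /= oppr0 !mulr0 subrr mul0r.
rewrite conj_e -eD /e /= mul1r; congr cos; rewrite /quad_gap /pow_gap /=; ring.
Qed.

(** Bounds the integral over [0 <= y <= lambda] of the term of index [t]. *)
Definition gap_weight (t : T3 * T3) : R :=
  if pow_gap t == 0 then lambda else Num.min lambda `|pow_gap t|^-1.

(** Integrate the expansion exactly, first in [y] and then in [x]: a sextuple with
    unequal sums of squares integrates to zero over the two periods, and the
    others keep twice their [y]-integral. *)
Lemma sixth_moment_le : (sixth_moment k c1 c2 N lambda <=
  (2 * \sum_(t | sum3 (expn^~ 2%N) Y t.1 == sum3 (expn^~ 2%N) Y t.2) gap_weight t)%:E)%E.
Proof.
have cut0 t : 0 <= gap_weight t.
  by rewrite /gap_weight; case: ifP => _ //; rewrite le_min lambda0 invr_ge0 normr_ge0.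
rewrite /sixth_moment; have [l0|ll0] := eqVneq lambda 0.
  rewrite l0 set_itv1.
  under eq_integral do rewrite integral_set1.
  by rewrite integral0 lee_fin mulr_ge0// sumr_ge0.
have l_gt0 : 0 < lambda by rewrite lt_neqAle eq_sym ll0.
pose C t := cos_prim (pow_gap t) lambda - cos_prim (pow_gap t) 0.
pose S t := sin_prim (pow_gap t) lambda - sin_prim (pow_gap t) 0.
have inner x : (\int[lebesgue_measure]_(y in `[0%R, lambda])
    (normc (expsum k c1 c2 N x y) ^+ 6)%:E)%E =
  (\sum_t (w t * C t * cos (2 * pi * quad_gap t * x)
     + (- (w t * S t)) * sin (2 * pi * quad_gap t * x)))%:E.
  transitivity (\int[lebesgue_measure]_(y in `[0%R, lambda]) (\sum_t
      (w t * cos (2 * pi * quad_gap t * x) * cos (2 * pi * pow_gap t * y)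
       + (- (w t * sin (2 * pi * quad_gap t * x))) * sin (2 * pi * pow_gap t * y)))%:E)%E.
    apply: eq_integral => y _; rewrite expsum6; congr (_%:E); apply: eq_bigr => t _.
    have -> : 2 * pi * (x * quad_gap t + y * pow_gap t)
      = 2 * pi * quad_gap t * x + 2 * pi * pow_gap t * y :> R by ring.
    by rewrite cosD; ring.
  rewrite trig_integral//; congr (_%:E); apply: eq_bigr => t _; rewrite /C /S; ring.
under eq_integral do rewrite inner.
have -> : [set x : R | `|x| <= 1] = [set` `[-1, 1]].
  by apply/seteqP; split => x /=; rewrite in_itv/= ler_norml.
rewrite trig_integral; last by lra.
rewrite lee_fin mulr_sumr [leRHS]big_mkcond/=; apply: ler_sum => t _.
rewrite sin_prim_period mulr0 addr0 cos_prim_period; case: ifP => _; last by rewrite mulr0.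
rewrite mulrC ler_wpM2l//.
have CC : C t <= gap_weight t.
  rewrite /gap_weight /C; case: ifPn => g0; first exact: cos_prim_le_length.
  by rewrite le_min cos_prim_le_length// cos_prim_le_inv.
rewrite /w; case: [&& _, _, _, _, _ & _]; rewrite ?mul1r ?mul0r//.
Qed.

End SixthMoment.

(** * Dyadic ranges and harmonic sums *)

Section Dyadic.
Variable R : realType.

(** [Y] is the least integer above [c1 * N]; it is comparable to [N], so that the
    range [n ~ N] sits in a window of length [kappa * Y] starting at [Y]. *)
Lemma dyadic_window (c1 c2 : R) : 0 < c1 -> c1 < c2 ->
  exists kappa : nat, forall N : R, 1 <= N -> exists Y : nat,
    [/\ (0 < Y)%N, c1 * N <= Y%:R, Y%:R <= (c1 + 1) * N &
        forall n, dyadic c1 c2 N n -> exists2 i, (i < kappa * Y)%N & n = (Y + i)%:Z].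
Proof.
move=> c10 c12; exists (Num.bound (c2 / c1)) => N N1.
set kappa := Num.bound _.
have N0 : 0 < N by exact: lt_le_trans N1.
have c20 : 0 < c2 by exact: lt_trans c12.
have hk : c2 < kappa%:R * c1.
  by rewrite -ltr_pdivrMr//; apply: archi_boundP; rewrite divr_ge0// ltW.
have exY : exists n : nat, c1 * N <= n%:R.
  exists (Num.bound (c1 * N)); rewrite ltW//; apply: archi_boundP.
  by rewrite mulr_ge0// ltW.
case: (ex_minnP exY) => Y hY Ymin; exists Y.
have Y0 : (0 < Y)%N.
  by rewrite -(ltr_nat R); apply: lt_le_trans hY; rewrite mulr_gt0.
have Y1 : Y%:R <= c1 * N + 1.
  have : ~~ (c1 * N <= Y.-1%:R).
    by apply/negP => /Ymin; rewrite leqNgt prednK// leqnn.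
  rewrite -ltNge => h; have -> : Y = Y.-1.+1 by rewrite prednK.
  by rewrite -natr1; lra.
split=> //; first by nra.
move=> n /andP[n1 n2]; have n0 : 0 < n.
  by rewrite -(ltr0z R); apply: lt_le_trans n1; rewrite mulr_gt0.
case: n n0 n1 n2 => // n _ n1 n2.
have Yn : (Y <= n)%N by apply: Ymin.
exists (n - Y)%N; last by rewrite subnKC.
have nk : (n < kappa * Y)%N.
  rewrite -(ltr_nat R); apply: le_lt_trans n2 _; rewrite natrM.
  have k0 : 0 <= kappa%:R :> R by [].
  have : c2 * N < kappa%:R * c1 * N by rewrite ltr_pM2r.
  have : kappa%:R * (c1 * N) <= kappa%:R * Y%:R by rewrite ler_wpM2l.
  by rewrite mulrA; lra.
by move: nk Y0 Yn; move: (kappa * Y)%N => z; lia.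
Qed.

Lemma sum_inv_le_ln n : \sum_(i < n.+1) i.+1%:R^-1 <= 1 + ln n.+1%:R :> R.
Proof.
elim: n => [|n IH]; first by rewrite big_ord1 invr1 ln1 addr0.
rewrite big_ord_recr/=; apply: (@le_trans _ _ (1 + ln n.+1%:R + n.+2%:R^-1)).
  by rewrite lerD2r.
rewrite -addrA lerD2l -lerBrDr.
have n1 : 0 < n.+1%:R :> R by rewrite ltr0n.
have n2 : 0 < n.+2%:R :> R by rewrite ltr0n.
have -> : ln n.+1%:R = ln n.+2%:R + ln (1 + - n.+2%:R^-1) :> R.
  rewrite -lnM ?posrE//.
    congr ln; rewrite mulrDr mulr1 mulrN divff ?gt_eqF//.
    by rewrite -[n.+2%:R]natr1 addrK.
  by rewrite subr_gt0 invf_lt1// ltr1n.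
rewrite lerD2l; apply: le_ln1Dx.
by rewrite ltrN2 invf_lt1// ltr1n.
Qed.

Lemma sum_inv_le_powR (delta : R) n : 0 < delta -> 
  \sum_(i < n.+1) i.+1%:R^-1 <= (1 + delta^-1) * n.+1%:R `^ delta.
Proof.
move=> d0; apply: le_trans (sum_inv_le_ln n) _.
have n1 : 1 <= n.+1%:R :> R by rewrite ler1n.
rewrite mulrDl mul1r lerD//.
  by rewrite -[leLHS](powRr0 n.+1%:R) ler_powR// ltW.
rewrite ler_pdivlMl// -ln_powR ltW// ln_sublinear// powR_gt0//.
Qed.

End Dyadic.

(** * The two bounds *)

Lemma Posz_exp (a n : nat) : (a ^ n)%N%:Z = a%:Z ^+ n.
Proof. by elim: n => // n IH; rewrite expnS PoszM IH exprS. Qed.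

Lemma window_sides (a b T w : nat) :
  (T <= absz (a%:Z - b%:Z))%N -> (absz (a%:Z - b%:Z) < T + w)%N ->
  (a + T <= b < a + T + w)%N || (b + T <= a < b + T + w)%N.
Proof. lia. Qed.

Section Final.
Variable R : realType.

(** The solutions are images of the pairs of triples of [window_count_abs] with no
    shift, at scale [W] just above [C * N ^ k.-1]. *)
Lemma card_system_solutions j (c1 c2 C : R) : 0 < c1 -> c1 < c2 -> 0 < C ->
  forall eps : R, 0 < eps -> exists A : R, forall N : R, 1 <= N ->
    finite_set (system_solutions j.+3 c1 c2 C N) /\
    #|` fset_set (system_solutions j.+3 c1 c2 C N)|%:R <= A * N `^ (3 + eps).
Proof.
move=> c10 c12 C0 eps eps0.
have [kappa hkappa] := dyadic_window c10 c12.
pose C' := Num.bound ((C + 1) / c1 ^+ j.+2).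
have [A A0 hA] := window_count_abs j kappa C' eps0.
exists (A * (c1 + 1) `^ (3 + eps)) => N N1.
have N0 : 0 < N by exact: lt_le_trans N1.
have [Y [Y0 Y1 Y2 hY]] := hkappa N N1.
pose W := (Num.truncn (C * N ^+ j.+2)).+1.
have NX1 : 1 <= N ^+ j.+2 by rewrite exprn_ege1.
have CN0 : 0 <= C * N ^+ j.+2 by rewrite mulr_ge0 ?exprn_ge0// ltW.
have hW : (W <= C' * Y ^ j.+2)%N.
  have c1X : 0 < c1 ^+ j.+2 by rewrite exprn_gt0.
  rewrite -(ler_nat R) natrM natrX.
  have : W%:R <= (C + 1) * N ^+ j.+2.
    rewrite /W -natr1 mulrDl mul1r lerD//.
    by rewrite truncn_le.
  move=> /le_trans; apply.
  apply: (@le_trans _ _ ((C + 1) / c1 ^+ j.+2 * (c1 * N) ^+ j.+2)).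
    by rewrite exprMn [leRHS]mulrA divfK// gt_eqF.
  have q0 : 0 <= (C + 1) / c1 ^+ j.+2 by rewrite divr_ge0 ?ltW// addr_gt0.
  have c1N : 0 <= c1 * N by rewrite mulr_ge0// ltW.
  apply: ler_pM => //; first by rewrite exprn_ge0.
    by rewrite ltW//; exact: archi_boundP.
  by rewrite lerXn2r// nnegrE.
set S := system_solutions _ _ _ _ _.
set l := (kappa * Y)%N in hY.
pose T3 := ('I_l * 'I_l * 'I_l)%type.
pose P (t : T3 * T3) := @window_solution j.+3 Y l W 0 t ||
        window_solution j.+3 Y W 0 (t.2, t.1).
pose z (i : 'I_l) : int := (Y + i)%:Z.
pose g (t : T3 * T3) : 6.-tuple int :=
  [tuple z t.1.1.1; z t.1.1.2; z t.1.2; z t.2.1.1; z t.2.1.2; z t.2.2].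
have SP n : S n -> exists2 t, P t & n = g t.
  move=> [dn kn sn].
  have zn (i : 'I_6) : exists i', tnth n i = z i'.
    by have [i' il ->] := hY _ (dn i); exists (Ordinal il).
  have [i1 e1'] := zn (inord 0); have [i2 e2] := zn (inord 1); have [i3 e3] := zn (inord 2).
  have [i4 e4] := zn (inord 3); have [i5 e5] := zn (inord 4); have [i6 e6] := zn (inord 5).
  rewrite !(tnth_nth 0) !inordK// in e1' e2 e3 e4 e5 e6.
  rewrite e1' e2 e3 e4 e5 e6 in kn sn.
  exists (i1, i2, i3, (i4, i5, i6)); last first.
    apply: val_inj; apply: (@eq_from_nth _ 0); first by rewrite size_tuple.
    by move=> [|[|[|[|[|[|i]]]]]]; rewrite size_tuple.
  have zX m (a1 a2 a3 : 'I_l) : z a1 ^+ m + z a2 ^+ m + z a3 ^+ m =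
      (sum3 (expn^~ m) Y (a1, a2, a3))%:Z.
    by rewrite /z -!Posz_exp -!PoszD.
  rewrite !zX in sn; rewrite -2!addrA -!opprD addrA !zX in kn.
  have {sn} s2 := sn; have [{}s2] := s2.
  have dW : (absz ((sum3 (expn^~ j.+3) Y (i1, i2, i3))%:Z
      - (sum3 (expn^~ j.+3) Y (i4, i5, i6))%:Z) < W)%N.
    by rewrite /W ltnS truncn_ge_nat// -[_%:R]/(_%:~R) abszE.
  rewrite /P /window_solution /= s2 eqxx /= !addn0; move: dW; clear; lia.
have finS : finite_set S.
  apply: (@sub_finite_set _ _ (g @` [set: T3 * T3])).
    by move=> n /SP[t _ ->]; exists t.
  by apply: finite_image; exact: finite_finset.
split=> //.
have sz : (#|` fset_set S| <= #|P|)%N.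
  rewrite cardE -(size_map g); apply: uniq_leq_size; first exact: fset_uniq.
  move=> n; rewrite in_fset_set// inE => /SP[t Pt ->].
  by apply: map_f; rewrite mem_enum.
apply: (@le_trans _ _ #|P|%:R); first by rewrite ler_nat.
apply: le_trans (hA Y W 0%N Y0 isT hW) _.
rewrite -mulrA ler_wpM2l// -powRM ?(ltW N0) ?addr_ge0 ?(ltW c10)//.
rewrite ge0_ler_powR ?nnegrE ?addr_ge0 ?(ltW eps0)//.
by rewrite mulr_ge0 ?(ltW N0)// addr_ge0// ltW.
Qed.

Lemma gap_bound j Y l (t : ('I_l * 'I_l * 'I_l) * ('I_l * 'I_l * 'I_l)) :
  (absz ((sum3 (expn^~ j.+3) Y t.1)%:Z - (sum3 (expn^~ j.+3) Y t.2)%:Z)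
    <= 3 * (Y + l) ^ j.+3)%N.
Proof.
have bd (u : 'I_l * 'I_l * 'I_l) : (sum3 (expn^~ j.+3) Y u <= 3 * (Y + l) ^ j.+3)%N.
  have h (i : 'I_l) : ((Y + i) ^ j.+3 <= (Y + l) ^ j.+3)%N.
    by rewrite leq_exp2r// leq_add2l ltnW.
  have := h u.1.1; have := h u.1.2; have := h u.2; rewrite /sum3; clear; lia.
by have := bd t.1; have := bd t.2; clear; lia.
Qed.

(** Sort the sextuples by the quotient [m] of their gap by [W = Y ^ k.-1].  Each class
    has [O(Y ^ (3 + eps / 2))] elements by the count with shift [m W], and weight
    at most [1 / (m W)], or [lambda] for [m = 0]; the harmonic sum over [m] costs
    another [Y ^ (eps / 2)]. *)
Lemma sum_gap_weight_le j (kappa : nat) (eps : R) : 0 < eps ->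
  exists2 B : R, 0 <= B & forall (Y : nat) (lambda : R), (0 < Y)%N -> 0 <= lambda ->
    \sum_(t | sum3 (l := kappa * Y) (expn^~ 2%N) Y t.1 == sum3 (expn^~ 2%N) Y t.2)
       @gap_weight R j.+3 lambda Y (kappa * Y) t
    <= B * (lambda * Y%:R `^ (3 + eps) + Y%:R `^ (3 + eps) / Y%:R ^+ j.+2).
Proof.
move=> eps0; pose d := eps / 2.
have d0 : 0 < d by rewrite divr_gt0.
have [A A0 hA] := window_count_abs j kappa 1 d0.
pose c := (3 * kappa.+1 ^ j.+3)%N.
pose B : R := A * (1 + d^-1) * (c + 1)%:R `^ d.
have B0 : 0 <= B by rewrite !mulr_ge0 ?powR_ge0// addr_ge0// invr_ge0 ltW.
exists (A + B); first exact: addr_ge0.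
move=> Y lambda Y0 l0; set l := (kappa * Y)%N.
pose W := (Y ^ j.+2)%N.
have W0 : (0 < W)%N by rewrite expn_gt0 Y0.
have W0' : 0 < W%:R :> R by rewrite ltr0n.
pose T3 := ('I_l * 'I_l * 'I_l)%type.
pose gap (t : T3 * T3) := absz ((sum3 (expn^~ j.+3) Y t.1)%:Z - (sum3 (expn^~ j.+3) Y t.2)%:Z).
pose J := (c * Y)%N.
have gapJ t : (gap t %/ W < J.+1)%N.
  rewrite ltnS; apply: (@leq_trans (3 * (Y + l) ^ j.+3 %/ W)).
    by rewrite leq_div2r// gap_bound.
  rewrite (_ : (3 * (Y + l) ^ j.+3)%N = (J * W)%N) ?mulnK//.
  by rewrite /J /c /W /l -[(Y + _)%N]mulSn expnMn [(Y ^ j.+3)%N]expnS; ring.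
pose v (m : nat) : R := if m == 0%N then lambda else (m * W)%:R^-1.
have v0 m : 0 <= v m by rewrite /v; case: ifP => _; rewrite ?invr_ge0.
have cut_le t : @gap_weight R j.+3 lambda Y l t <= v (gap t %/ W)%N.
  have gE : `|pow_gap R j.+3 Y t| = (gap t)%:R.
    by rewrite /pow_gap /gap natr_absz intr_norm rmorphB.
  rewrite /gap_weight -normr_eq0 gE pnatr_eq0 /v.
  have [->|g0] := eqVneq (gap t) 0%N; first by rewrite div0n.
  case: eqP => [_|/eqP m0]; first by rewrite ge_min lexx.
  have gp : (0 < gap t)%N by rewrite lt0n.
  have mW : (0 < gap t %/ W * W)%N by rewrite muln_gt0 W0 lt0n m0.
  by rewrite ge_min lef_pV2 ?posrE ?ltr0n// ler_nat leq_divM orbT.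
pose Z : R := Y%:R `^ (3 + d).
have Z0 : 0 <= Z by exact: powR_ge0.
have le1 : \sum_(t | sum3 (expn^~ 2%N) Y t.1 == sum3 (expn^~ 2%N) Y t.2) @gap_weight R j.+3 lambda Y l t
    <= \sum_(m < J.+1) A * Z * v m.
  rewrite (partition_big (fun t => Ordinal (gapJ t)) predT)//=.
  apply: ler_sum => m _.
  apply: (@le_trans _ _ (\sum_(t | (sum3 (expn^~ 2%N) Y t.1 == sum3 (expn^~ 2%N) Y t.2)
      && (Ordinal (gapJ t) == m)) v m)).
    by apply: ler_sum => t /andP[_ /eqP <-]; exact: cut_le.
  rewrite sumr_const -[leLHS]mulr_natl ler_wpM2r//.
  apply: le_trans (hA Y W (m * W)%N Y0 W0 _); last by rewrite mul1n.
  rewrite ler_nat; apply: (@card_inj_le_in _ _ _ _ id) => // t; rewrite !inE.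
  move=> /andP[/eqP s2 /eqP/(congr1 val)/= gm].
  have g1 : (m * W <= gap t)%N by rewrite -gm leq_divM.
  have g2 : (gap t < m * W + W)%N by rewrite -gm addnC -mulSn ltn_ceil.
  rewrite /window_solution /= s2 eqxx /=; move: g1 g2; rewrite /gap.
  exact: window_sides.
apply: le_trans le1 _; rewrite -mulr_sumr big_ord_recl /= {1}/v eqxx.
have -> : \sum_(i < J) v (bump 0 i) = W%:R^-1 * \sum_(i < J) i.+1%:R^-1.
  rewrite mulr_sumr; apply: eq_bigr => i _; rewrite /v /bump /= add1n natrM invfM mulrC.
  by [].
pose Yd : R := Y%:R `^ d.
have Yd1 : 1 <= Yd.
  by rewrite /Yd -[leLHS](powRr0 Y%:R) ler_powR ?ler1n// ltW.
have harm : \sum_(i < J) i.+1%:R^-1 <= (1 + d^-1) * ((c + 1)%:R `^ d * Yd).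
  have J0 : (J <= J.+1)%N by [].
  apply: (@le_trans _ _ (\sum_(i < J.+1) i.+1%:R^-1)).
    by rewrite big_ord_recr/= lerDl invr_ge0.
  apply: le_trans (sum_inv_le_powR J d0) _.
  rewrite ler_wpM2l ?addr_ge0 ?invr_ge0 ?(ltW d0)//.
  rewrite -powRM// ge0_ler_powR ?nnegrE ?(ltW d0)// -natrM ler_nat.
  by rewrite /J mulnDl mul1n -addn1 leq_add2l.
have ZE : Y%:R `^ (3 + eps) = Z * Yd.
  rewrite /Z /Yd -powRD; last by rewrite pnatr_eq0 -lt0n Y0 implybT.
  by congr (_ `^ _); rewrite /d; field.
rewrite ZE -/W.
have -> : Y%:R ^+ j.+2 = W%:R :> R by rewrite /W natrX.
have h1 : A * Z * lambda <= A * (lambda * (Z * Yd)).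
  rewrite -mulrA ler_wpM2l// mulrC ler_wpM2l// -[leLHS]mulr1 ler_wpM2l//.
have h2 : A * Z * (W%:R^-1 * \sum_(i < J) i.+1%:R^-1) <= B * (Z * Yd / W%:R).
  have -> : B * (Z * Yd / W%:R) = A * Z * (W%:R^-1 * ((1 + d^-1) * ((c + 1)%:R `^ d * Yd))).
    by rewrite /B; ring.
  by rewrite ler_wpM2l ?mulr_ge0// ler_wpM2l// invr_ge0.
have h3 : 0 <= A * (Z * Yd / W%:R).
  by rewrite mulr_ge0 ?divr_ge0 ?mulr_ge0 ?powR_ge0.
have h4 : 0 <= B * (lambda * (Z * Yd)).
  by rewrite mulr_ge0// mulr_ge0// mulr_ge0 ?powR_ge0.
by rewrite mulrDr; lra.
Qed.

Lemma sixth_moment_bound j (c1 c2 : R) : 0 < c1 -> c1 < c2 ->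
  forall eps : R, 0 < eps -> exists A : R, forall N lambda : R,
    1 <= N -> 0 <= lambda <= 1 ->
    (sixth_moment j.+3 c1 c2 N lambda <=
      (A * (lambda * N `^ (3 + eps) + N `^ (4 - j.+3%:R + eps)))%:E)%E.
Proof.
move=> c10 c12 eps eps0.
have [kappa hkappa] := dyadic_window c10 c12.
have [B B0 hB] := sum_gap_weight_le j kappa eps0.
pose c3 : R := (c1 + 1) `^ (3 + eps).
have c30 : 0 <= c3 by exact: powR_ge0.
pose c4 : R := (c1 ^+ j.+2)^-1.
have c40 : 0 <= c4 by rewrite invr_ge0 exprn_ge0// ltW.
exists (2 * B * c3 * (1 + c4)) => N lambda N1 /andP[l0 _].
have N0 : 0 < N by exact: lt_le_trans N1.
have [Y [Y0 Y1 Y2 hY]] := hkappa N N1.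
apply: le_trans (sixth_moment_le j.+3 l0 hY) _.
rewrite lee_fin -!mulrA ler_wpM2l//; apply: le_trans (hB Y lambda Y0 l0) _.
rewrite ler_wpM2l//.
have YN : Y%:R `^ (3 + eps) <= c3 * N `^ (3 + eps).
  rewrite -powRM ?(ltW N0) ?addr_ge0 ?(ltW c10)//.
  rewrite ge0_ler_powR ?nnegrE ?addr_ge0 ?(ltW eps0)//.
  by rewrite mulr_ge0 ?(ltW N0)// addr_ge0// ltW.
have NE : N `^ (4 - j.+3%:R + eps) = N `^ (3 + eps) / N ^+ j.+2.
  have -> : 4 - j.+3%:R + eps = (3 + eps) - j.+2%:R by rewrite -[j.+3%:R]natr1; ring.
  by rewrite powRB ?powR_mulrn ?(ltW N0)// (gt_eqF N0) implybT.
have YV : (Y%:R ^+ j.+2)^-1 <= c4 / N ^+ j.+2.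
  rewrite /c4 -invfM -exprMn lef_pV2 ?posrE ?exprn_gt0 ?mulr_gt0 ?ltr0n//.
  by rewrite lerXn2r ?nnegrE// mulr_ge0// ltW.
have NV : 0 <= (N ^+ j.+2)^-1 by rewrite invr_ge0 exprn_ge0// ltW.
rewrite NE; set x := N `^ _ in YN *; set y := Y%:R `^ _ in YN *.
have x0 : 0 <= x by exact: powR_ge0.
have y0 : 0 <= y by exact: powR_ge0.
have h1 : lambda * y <= lambda * (c3 * x) by rewrite ler_wpM2l.
have h2 : y / Y%:R ^+ j.+2 <= (c3 * x) * (c4 / N ^+ j.+2).
  by apply: ler_pM => //; rewrite invr_ge0 exprn_ge0.
have h3 : 0 <= c3 * (c4 * (lambda * x)) by rewrite !mulr_ge0.
have h4 : 0 <= c3 * (x / N ^+ j.+2) by rewrite !mulr_ge0.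
apply: le_trans (lerD h1 h2) _.
have -> : c3 * ((1 + c4) * (lambda * x + x / N ^+ j.+2)) =
  lambda * (c3 * x) + c3 * x * (c4 / N ^+ j.+2) + c3 * (c4 * (lambda * x)) + c3 * (x / N ^+ j.+2) by ring.
lra.
Qed.

End Final.

Theorem theorem2p19 (R : realType) (k : nat) (hk : (4 <= k)%N)
    (c1 c2 : R) (hc1 : 0 < c1) (hc12 : c1 < c2) :
  (forall eps : R, 0 < eps ->
     exists A : R, forall N lambda : R, 1 <= N -> 0 <= lambda <= 1 ->
       (sixth_moment k c1 c2 N lambda <=
          (A * (lambda * N `^ (3 + eps) + N `^ (4 - k%:R + eps)))%:E)%E)
  /\
  (forall C : R, 0 < C -> forall eps : R, 0 < eps ->
     exists A : R, forall N : R, 1 <= N ->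
       finite_set (system_solutions k c1 c2 C N) /\
       #|` fset_set (system_solutions k c1 c2 C N)|%:R
         <= A * N `^ (3 + eps)).
Proof.
case: k hk => [|[|[|j]]]// _; split; first exact: sixth_moment_bound.
by move=> C C0; exact: card_system_solutions.
Qed.
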